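(* Let $w \in S_n$ be a permutation. Then $w$ has a factorization $w = uv$ with $u, v \in S_n$ such that $u$ avoids the patterns $1324$, $2413$ and $3142$, $v$ avoids the patterns $132$ and $312$, and $\ell(uv) = \ell(u) - \ell(v)$, if and only if $w$ avoids the following 13 patterns: \[51324,\ 15324,\ 52413,\ 25413,\ 53142,\ 35142,\ 31542,\] \[143265,\ 143625,\ 143652,\ 146352,\ 413265,\ 413625.\] Therefore, for any permutation $w$ avoiding these 13 patterns, the Schubert polynomial $\mathfrak S_w$ has a proper lattice path representation.
   Context: Permutations: $S_n$ is the group of permutations of $\{1,\dots,n\}$, written in one-line notation $w = w_1 w_2\cdots w_n$; products are compositions, $(uv)(i) = u(v(i))$. The length $\ell(w)$ is the number of inversions (pairs $i<j$ with $w_i>w_j$). A permutation $w\in S_n$ contains a pattern $p \in S_k$ if there are $i_1<\dots<i_k$ such that $w_{i_a}<w_{i_b}$ if and only if $p_a<p_b$; otherwise $w$ avoids $p$. Schubert polynomials: let $s_i=(i\ \, i+1)$, which acts on polynomials by exchanging $x_i$ and $x_{i+1}$, and let $\partial_i f = (f - s_i f)/(x_i - x_{i+1})$ for $i \ge 1$. With $w_0 = n(n-1)\cdots 1 \in S_n$, set $\mathfrak S_{w_0} = x_1^{n-1}x_2^{n-2}\cdots x_{n-1}$ and $\mathfrak S_{ws_i} = \partial_i \mathfrak S_w$ whenever $\ell(ws_i)<\ell(w)$; this defines $\mathfrak S_w$ for all $w\in S_n$. Lattice path representations: let $G$ be the directed graph with vertex set $\mathbb Z\times \mathbb Z_{\ge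 0}$ and, for all $a\in\mathbb Z$, $b\ge 0$, an edge from $(a,b)$ to $(a,b+1)$ of weight $x_{b+1}$ and an edge from $(a,b)$ to $(a-1,b+1)$ of weight $1$. The weight of a directed path is the product of its edge weights (a single vertex is a path of weight $1$). Let $A = \{(a_1,0),\dots,(a_k,0)\}$ and $B=\{(b_1,c_1),\dots,(b_k,c_k)\}$ be lists of vertices of $G$ (so $a_i,b_i\in\mathbb Z$, $c_i\in\mathbb Z_{\ge0}$). Let $\mathscr P(A,B)$ be the set of all tuples $P = (P_1,\dots,P_k)$ of pairwise vertex-disjoint directed paths such that for some $\sigma = \sigma(P)\in S_k$, $P_i$ goes from $(a_i,0)$ to $(b_{\sigma(i)},c_{\sigma(i)})$ for all $i$; let $w(P)$ be the product of the weights of the $P_i$. A polynomial $F\in\mathbb Z[x_1,x_2,\dots]$ has lattice path representation $(A,B)$ if $F = \sum_{P\in\mathscr P(A,B)} \operatorname{sgn}(\sigma(P))\, w(P)$. The representation is proper if the heights $c_1,\dots,c_k$ are distinct. *)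

(* Defs.v *)
From HB Require Import structures.
From mathcomp Require Import all_boot all_order all_algebra all_fingroup.
From mathcomp Require Import mpoly ring.
From mathcomp Require monalg.

Set Implicit Arguments.
Unset Strict Implicit.
Unset Printing Implicit Defensive.

Import GRing.Theory.
Local Open Scope ring_scope.

(** * Permutations *)

(* Indices and values are 0-based: [w i] for [i : 'I_n] stands for
   $w_{i+1} - 1$. *)

(* MathComp composes permutations left to right, [(u * v)%g i = v (u i)];
   [comp_perm u v] is the product $uv$ with $(uv)(i) = u(v(i))$. *)
Definition comp_perm n (u v : 'S_n) : 'S_n := (v * u)%g.

Lemma comp_permE n (u v : 'S_n) i : comp_perm u v i = u (v i).
Proof. exact: permM. Qed.

Definition inversions n (w : 'S_n) : {set 'I_n * 'I_n} :=
  [set ij : 'I_n * 'I_n | (ij.1 < ij.2)%N && (w ij.2 < w ij.1)%N].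

Definition ell n (w : 'S_n) : nat := #|inversions w|.

Definition w0 n : 'S_n := perm (@rev_ord_inj n).

(* A pattern is given by its one-line notation. *)
Definition contains n (w : 'S_n) (p : seq nat) : Prop :=
  exists f : 'I_(size p) -> 'I_n,
    (forall a b : 'I_(size p), (a < b)%N -> (f a < f b)%N) /\
    (forall a b : 'I_(size p),
       (w (f a) < w (f b))%N = (nth 0%N p a < nth 0%N p b)%N).

Definition avoids n (w : 'S_n) (ps : seq (seq nat)) : Prop :=
  forall p, p \in ps -> ~ contains w p.

(** * Divided differences *)

Lemma msymXi n (s : 'S_n) (i : 'I_n) :
  msym s ('X_i : {mpoly int[n]}) = 'X_(s i).
Proof.
rewrite msymX; congr 'X_[_]; apply/mnmP=> k.
by rewrite mnmE !mnm1E -(inj_eq (@perm_inj _ s)) permKV.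
Qed.

Lemma ddiff_ex n (i j : 'I_n) (f : {mpoly int[n]}) :
  exists g : {mpoly int[n]}, g * ('X_i - 'X_j) == f - msym (tperm i j) f.
Proof.
pose P (f : {mpoly int[n]}) := exists g : {mpoly int[n]},
  g * ('X_i - 'X_j) = f - msym (tperm i j) f.
have PM p q : P p -> P q -> P (p * q).
  move=> [p' Hp] [q' Hq]; exists (p' * q + msym (tperm i j) p * q').
  rewrite msymM mulrDl -mulrA [q * _]mulrC mulrA Hp -mulrA Hq; ring.
have PX k : P 'X_k.
  rewrite /P msymXi; case: tpermP => [->|->|_ _].
  - by exists 1; rewrite mul1r.
  - by exists (-1); ring.
  - by exists 0; rewrite mul0r subrr.
have P1 : P 1 by exists 0; rewrite msym1 mul0r subrr.
suff [g Hg] : P f by exists g; apply/eqP.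
elim/mpolyind: f => [|c m p _ _ [g Hg]].
  by exists 0; rewrite msym0 mul0r subrr.
have [h Hh] : P 'X_[m].
  rewrite mpolyXE_id; elim/big_ind: _ => // k _.
  by elim: (m k) => [|e IH]; rewrite ?expr0 ?exprS //; apply: PM.
exists (c *: h + g).
by rewrite mulrDl -scalerAl Hg Hh msymD msymZ scalerBr opprD addrACA.
Qed.

(* The divided difference $\partial_i$ is [ddiff i j] with [j = i.+1]; the
   quotient is unique for [i != j], as {mpoly int[n]} is a domain. *)
HB.lock Definition ddiff n (i j : 'I_n) (f : {mpoly int[n]}) : {mpoly int[n]} :=
  xchoose (ddiff_ex i j f).

Lemma ddiffP n (i j : 'I_n) (f : {mpoly int[n]}) :
  ddiff i j f * ('X_i - 'X_j) = f - msym (tperm i j) f.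
Proof. by rewrite unlock; exact/eqP/(xchooseP (ddiff_ex i j f)). Qed.

Lemma mpolyX_sub_neq0 n (i j : 'I_n) : i != j ->
  ('X_i - 'X_j : {mpoly int[n]}) != 0.
Proof.
move=> ij; apply/eqP=> /(congr1 (meval (fun k => (k == i)%:R))).
by rewrite mevalB !mevalXU meval0 eqxx eq_sym (negPf ij).
Qed.

Lemma mulf_mpolyX_sub n (i j : 'I_n) (p q : {mpoly int[n]}) : i != j ->
  p * ('X_i - 'X_j) = q * ('X_i - 'X_j) -> p = q.
Proof. by move=> ij; apply: mulIf; apply: mpolyX_sub_neq0. Qed.

Lemma ddiffN n (i j : 'I_n) (f : {mpoly int[n]}) : i != j ->
  ddiff i j (- f) = - ddiff i j f.
Proof.
by move=> ij; apply: (mulf_mpolyX_sub ij); rewrite mulNr !ddiffP msymN; ring.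
Qed.

Lemma ddiffC n (i j : 'I_n) (f : {mpoly int[n]}) : i != j ->
  ddiff i j f = - ddiff j i f.
Proof.
move=> ij; apply: (mulf_mpolyX_sub ij).
transitivity (ddiff j i f * ('X_j - 'X_i)); last by ring.
by rewrite !ddiffP tpermC.
Qed.

Lemma ddiff_comm n (a b c d : 'I_n) (f : {mpoly int[n]}) :
  a != b -> c != d -> a != c -> a != d -> b != c -> b != d ->
  ddiff a b (ddiff c d f) = ddiff c d (ddiff a b f).
Proof.
move=> ab cd ac ad bc bd.
apply: (mulf_mpolyX_sub ab); apply: (mulf_mpolyX_sub cd).
have E x y z t (g : {mpoly int[n]}) : x != z -> x != t -> y != z -> y != t ->
  ddiff x y (ddiff z t g) * ('X_x - 'X_y) * ('X_z - 'X_t) =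
  g - msym (tperm z t) g
    - (msym (tperm x y) g - msym (tperm z t * tperm x y)%g g).
  move=> xz xt yz yt; rewrite ddiffP mulrBl ddiffP.
  have := congr1 (msym (tperm x y)) (ddiffP z t g).
  rewrite msymM !msymB !msymXi !tpermD // -msymMm => ->; ring.
have ca : c != a by rewrite eq_sym.
have da : d != a by rewrite eq_sym.
have cb : c != b by rewrite eq_sym.
have db : d != b by rewrite eq_sym.
apply: (etrans (E _ _ _ _ f ac ad bc bd)).
apply: (etrans _ (mulrAC _ _ _)).
apply: (etrans _ (esym (E _ _ _ _ f ca cb da db))).
have -> : (tperm c d * tperm a b = tperm a b * tperm c d)%g.
  apply/permP=> k; rewrite !permM.
  case: (tpermP a b k) => [->|->|/eqP ka /eqP kb].
  - by rewrite (tpermD ca da) tpermL (tpermD cb db).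
  - by rewrite (tpermD cb db) tpermR (tpermD ca da).
  case: (tpermP c d k) => [_|_|_ _].
  - by rewrite (tpermD ad bd).
  - by rewrite (tpermD ac bc).
  by rewrite tpermD // eq_sym.
ring.
Qed.

Lemma ddiff_braid n (a b c : 'I_n) (f : {mpoly int[n]}) :
  a != b -> b != c -> a != c ->
  ddiff a b (ddiff b c (ddiff a b f)) = ddiff b c (ddiff a b (ddiff b c f)).
Proof.
move=> ab bc ac.
have E x y z (g : {mpoly int[n]}) : x != y -> y != z -> x != z ->
  ddiff x y (ddiff y z (ddiff x y g))
    * ('X_x - 'X_y) * ('X_y - 'X_z) * ('X_x - 'X_z) =
  g - msym (tperm x y) g - msym (tperm y z) g
    + msym (tperm x y * tperm y z)%g g + msym (tperm y z * tperm x y)%g g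
    - msym (tperm x y * tperm y z * tperm x y)%g g.
  move=> xy yz xz.
  have zx : z != x by rewrite eq_sym.
  have yx : y != x by rewrite eq_sym.
  have zy : z != y by rewrite eq_sym.
  set p := ddiff x y g; set q := ddiff y z p.
  have Hp : p * ('X_x - 'X_y) = g - msym (tperm x y) g by exact: ddiffP.
  have Hq : q * ('X_y - 'X_z) = p - msym (tperm y z) p by exact: ddiffP.
  have Htp := congr1 (msym (tperm y z)) Hp.
  rewrite msymM !msymB !msymXi -msymMm (tpermD yx zx) tpermL in Htp.
  have Hsp : msym (tperm x y) p = p.
    apply: (mulf_mpolyX_sub xy); have := congr1 (msym (tperm x y)) Hp.
    rewrite msymM !msymB !msymXi -msymMm tpermL tpermR tperm2 msym1m => Hs.
    transitivity (- (msym (tperm x y) p * ('X_y - 'X_x))); first by ring.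
    rewrite Hs Hp; ring.
  have Hsq := congr1 (msym (tperm x y)) Hq.
  rewrite msymM !msymB !msymXi Hsp tpermR (tpermD xz yz) in Hsq.
  have Hstp := congr1 (msym (tperm x y)) Htp.
  rewrite msymM !msymB !msymXi tpermL (tpermD xz yz) -2!(msymMm g) in Hstp.
  rewrite ddiffP.
  transitivity (q * ('X_y - 'X_z) * ('X_x - 'X_z)
    - msym (tperm x y) q * ('X_x - 'X_z) * ('X_y - 'X_z)); first by ring.
  rewrite Hq Hsq.
  transitivity (p * ('X_x - 'X_y) - msym (tperm y z) p * ('X_x - 'X_z)
    + msym (tperm x y) (msym (tperm y z) p) * ('X_y - 'X_z)); first by ring.
  rewrite Hp Htp Hstp; ring.
have ba : b != a by rewrite eq_sym.
have cb : c != b by rewrite eq_sym.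
have ca : c != a by rewrite eq_sym.
have H1 := E _ _ _ f ab bc ac; have H2 := E _ _ _ f cb ba ca.
rewrite !(ddiffC _ cb) (ddiffC _ ba) !ddiffN // opprK in H2.
apply: (mulf_mpolyX_sub ab); apply: (mulf_mpolyX_sub bc).
apply: (mulf_mpolyX_sub ac); rewrite {}H1.
move: H2; set L := ddiff b c _ => H2.
transitivity (- L * ('X_c - 'X_b) * ('X_b - 'X_a) * ('X_c - 'X_a));
  last by ring.
rewrite {}H2 (tpermC c b) (tpermC b a).
have -> : (tperm a b * tperm b c * tperm a b =
           tperm b c * tperm a b * tperm b c)%g.
  have -> : (tperm a b * tperm b c * tperm a b = tperm b c ^ tperm a b)%g.
    by rewrite conjgE tpermV mulgA.
  have -> : (tperm b c * tperm a b * tperm b c = tperm a b ^ tperm b c)%g.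
    by rewrite conjgE tpermV mulgA.
  by rewrite !tpermJ tpermR tpermL (tpermD ac bc) (tpermD ba ca).
ring.
Qed.

(** * Schubert polynomials *)

(* The defining rules: the value at $w_0$, and $S_{w s_i} = \partial_i S_w$
   whenever $\ell(w s_i) < \ell(w)$, where [tperm i j] is $s_i$. *)
Definition schubert_family n (S : {ffun 'S_n -> {mpoly int[n]}}) : bool :=
  (S (w0 n) == \prod_(i < n) 'X_i ^+ (n.-1 - i)) &&
  [forall w : 'S_n, forall i : 'I_n, forall j : 'I_n,
    (j == i.+1 :> nat) && (ell (comp_perm w (tperm i j)) < ell w)%N ==>
    (S (comp_perm w (tperm i j)) == ddiff i j (S w))].

Lemma ell_ascent n (w : 'S_n) (i j : 'I_n) :
  j = i.+1 :> nat -> (w i < w j)%N ->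
  (ell w < ell (comp_perm w (tperm i j)))%N.
Proof.
move=> ji wij; pose s := tperm i j.
pose g (p : 'I_n * 'I_n) := (s p.1, s p.2).
have g_inj : injective g.
  by move=> [a b] [c d] [/perm_inj -> /perm_inj ->].
have ij : i != j by rewrite -val_eqE /= ji neq_ltn ltnSn.
rewrite /ell -(card_imset _ g_inj) [X in (_ < X)%N](cardsD1 (i, j)).
rewrite /inversions inE /= !comp_permE tpermL tpermR wij ji ltnSn add1n ltnS.
apply/subset_leq_card/subsetP=> _ /imsetP[[a b] ab ->].
move: ab; rewrite !inE /= => /andP[ab wba].
rewrite !comp_permE !tpermK wba andbT xpair_eqE /s; apply/andP; split.
  apply/negP=> /andP[/eqP si /eqP sj]; move: ab.
  rewrite -(tpermK i j a) si tpermL -(tpermK i j b) sj tpermR ji.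
  by rewrite ltnNge leqnSn.
move: wba ab.
case: (tpermP i j a) => [->|->|/eqP ai /eqP aj];
  case: (tpermP i j b) => [->|->|/eqP bi /eqP bj]; rewrite ?ltnn ?ji //.
- by rewrite ltnNge (ltnW wij).
- by move=> _; rewrite leq_eqVlt eq_sym -ji val_eqE (negPf bj).
- by move=> _ /ltnW.
- by move=> _ /ltnW; rewrite ltnS.
by move=> _; rewrite ltnS leq_eqVlt val_eqE (negPf ai).
Qed.

Lemma comp_perm_tpermK n (w : 'S_n) (i j : 'I_n) :
  comp_perm (comp_perm w (tperm i j)) (tperm i j) = w.
Proof. by rewrite /comp_perm mulgA tperm2 mul1g. Qed.

Lemma ell_descent n (w : 'S_n) (i j : 'I_n) : j = i.+1 :> nat ->
  (ell (comp_perm w (tperm i j)) < ell w)%N = (w j < w i)%N.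
Proof.
move=> ji; have ij : i != j by rewrite -val_eqE /= ji neq_ltn ltnSn.
case: (ltngtP (w i) (w j)) => [wij|wji|/val_inj/perm_inj/eqP].
- by apply/negbTE; rewrite -leqNgt ltnW // ell_ascent.
- have := @ell_ascent n (comp_perm w (tperm i j)) i j ji.
  by rewrite !comp_permE tpermL tpermR comp_perm_tpermK; apply.
by rewrite (negPf ij).
Qed.

Lemma ell_le n (w : 'S_n) : (ell w <= n * n)%N.
Proof. by rewrite (leq_trans (max_card _)) // card_prod card_ord. Qed.

Lemma schubert_familyP n (S : {ffun 'S_n -> {mpoly int[n]}}) :
  reflect (S (w0 n) = \prod_(i < n) 'X_i ^+ (n.-1 - i) /\
    forall (w : 'S_n) (i j : 'I_n), j = i.+1 :> nat ->
      (ell (comp_perm w (tperm i j)) < ell w)%N ->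
      S (comp_perm w (tperm i j)) = ddiff i j (S w))
    (schubert_family S).
Proof.
apply: (iffP andP) => -[/eqP S0 SD]; split=> //; last first.
- apply/forallP=> w; apply/forallP=> i; apply/forallP=> j.
  by apply/implyP=> /andP[/eqP ji lt]; apply/eqP/SD.
move=> w i j ji lt.
move/forallP/(_ w)/forallP/(_ i)/forallP/(_ j): SD.
by rewrite ji eqxx lt => /eqP.
Qed.

Lemma schubert_family_ex n :
  exists S : {ffun 'S_n -> {mpoly int[n]}}, schubert_family S.
Proof.
pose d (w : 'S_n) := (n * n - ell w)%N.
pose xd : {mpoly int[n]} := \prod_(i < n) 'X_i ^+ (n.-1 - i).
pose asc (w : 'S_n) (p : 'I_n * 'I_n) :=
  (p.2 == p.1.+1 :> nat) && (w p.1 < w p.2)%N.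
have d_asc w i j : asc w (i, j) -> (d (comp_perm w (tperm i j)) < d w)%N.
  move=> /andP[/eqP ji wij]; have lt := ell_ascent ji wij.
  by rewrite ltn_sub2l // (leq_trans lt) // ell_le.
suff [S [S0 SA]] : exists S : 'S_n -> {mpoly int[n]}, S (w0 n) = xd /\
    forall w i j, (d w < (n * n).+1)%N -> asc w (i, j) ->
      S w = ddiff i j (S (comp_perm w (tperm i j))).
  exists (finfun S); apply/schubert_familyP; rewrite !ffunE; split=> //.
  move=> w i j ji; rewrite ell_descent // => wji; rewrite !ffunE.
  rewrite (SA _ i j) ?comp_perm_tpermK // ?ltnS ?leq_subr //.
  by rewrite /asc /= ji eqxx !comp_permE tpermL tpermR.
elim: (n * n).+1 => [|m [S [S0 SA]]]; first by exists (fun=> xd).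
exists (fun w => if (d w < m)%N then S w else
  if [pick p | asc w p] is Some p
  then ddiff p.1 p.2 (S (comp_perm w (tperm p.1 p.2))) else xd).
split.
  case: ifP => // _; case: pickP => // -[i j] /andP[/= /eqP ji].
  rewrite !permE /= ltnNge leq_sub2l // ji; exact: leqW.
move=> w i j; rewrite ltnS => dm wij.
have dij := d_asc _ _ _ wij.
rewrite (leq_trans dij dm).
case: ltnP => [dw|_]; first exact: SA.
case: pickP => [[k l] /= wkl|/(_ (i, j))]; last by rewrite wij.
have dkl := d_asc _ _ _ wkl.
have {}SA v a b : (d v < d w)%N -> asc v (a, b) ->
    S v = ddiff a b (S (comp_perm v (tperm a b))).
  by move=> dv; apply: SA; apply: leq_trans dv dm.
wlog: i j k l wij dij wkl dkl / (i <= k)%N.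
  by case: (leqP i k) => [ik|/ltnW ki] H; [|apply/esym]; apply: H.
have /andP[/= /eqP ji Hij] := wij; have /andP[/= /eqP lk Hkl] := wkl.
have nij : i != j by rewrite -val_eqE /= ji neq_ltn ltnSn.
have nkl : k != l by rewrite -val_eqE /= lk neq_ltn ltnSn.
rewrite leq_eqVlt => /orP[/eqP/val_inj ik|].
  by subst k; have -> : l = j by apply/val_inj; rewrite /= ji lk.
rewrite leq_eqVlt -ji => /orP[/eqP/val_inj jk|jk].
  subst k; have nil : i != l.
    by rewrite -val_eqE /= lk ji neq_ltn ltnS leqnSn.
  have nli : l != i by rewrite eq_sym.
  have nlj : l != j by rewrite eq_sym.
  have nji : j != i by rewrite eq_sym.
  have Hil := ltn_trans Hij Hkl.
  have a1 : asc (comp_perm w (tperm i j)) (j, l).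
    by rewrite /asc /= lk eqxx !comp_permE tpermR (tpermD nil nkl).
  have a2 : asc (comp_perm w (tperm j l)) (i, j).
    by rewrite /asc /= ji eqxx !comp_permE tpermL (tpermD nji nli).
  have d1 := ltn_trans (d_asc _ _ _ a1) dij.
  have d2 := ltn_trans (d_asc _ _ _ a2) dkl.
  have b1 : asc (comp_perm (comp_perm w (tperm i j)) (tperm j l)) (i, j).
    rewrite /asc /= ji eqxx !comp_permE tpermL (tpermD nji nli) tpermL.
    by rewrite (tpermD nil nkl).
  have b2 : asc (comp_perm (comp_perm w (tperm j l)) (tperm i j)) (j, l).
    rewrite /asc /= lk eqxx !comp_permE tpermR (tpermD nil nkl) tpermR.
    by rewrite (tpermD nji nli).
  rewrite (SA _ _ _ dij a1) (SA _ _ _ dkl a2) (SA _ _ _ d1 b1) (SA _ _ _ d2 b2).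
  rewrite ddiff_braid //; congr (ddiff _ _ (ddiff _ _ (ddiff _ _ (S _)))).
  rewrite /comp_perm !mulgA; congr (_ * _)%g.
  have -> : (tperm j l * tperm i j * tperm j l = tperm i j ^ tperm j l)%g.
    by rewrite conjgE tpermV mulgA.
  have -> : (tperm i j * tperm j l * tperm i j = tperm j l ^ tperm i j)%g.
    by rewrite conjgE tpermV mulgA.
  by rewrite !tpermJ tpermR tpermL (tpermD nil nkl) (tpermD nji nli).
have njk : j != k by rewrite -val_eqE /= neq_ltn jk.
have nik : i != k by rewrite -val_eqE /= neq_ltn (ltn_trans _ jk) // ji.
have njl : j != l by rewrite -val_eqE /= neq_ltn lk (ltn_trans jk).
have nil : i != l.
  by rewrite -val_eqE /= neq_ltn lk ltnS ltnW // (ltn_trans _ jk) // ji.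
have nki : k != i by rewrite eq_sym.
have nli : l != i by rewrite eq_sym.
have nkj : k != j by rewrite eq_sym.
have nlj : l != j by rewrite eq_sym.
have a1 : asc (comp_perm w (tperm i j)) (k, l).
  by rewrite /asc /= lk eqxx !comp_permE (tpermD nik njk) (tpermD nil njl).
have a2 : asc (comp_perm w (tperm k l)) (i, j).
  by rewrite /asc /= ji eqxx !comp_permE (tpermD nki nli) (tpermD nkj nlj).
rewrite (SA _ _ _ dij a1) (SA _ _ _ dkl a2).
rewrite ddiff_comm // 1?eq_sym //; congr (ddiff _ _ (ddiff _ _ (S _))).
rewrite /comp_perm !mulgA; congr (_ * _)%g.
have C : (tperm k l ^ tperm i j = tperm k l)%g.
  by rewrite tpermJ (tpermD nik njk) (tpermD nil njl).
by rewrite -[in RHS]C conjgE tpermV -!mulgA tperm2 mulg1.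
Qed.

Lemma schubert_family_uniq n (S T : {ffun 'S_n -> {mpoly int[n]}}) :
  schubert_family S -> schubert_family T -> S = T.
Proof.
move=> /schubert_familyP[S0 SD] /schubert_familyP[T0 TD]; apply/ffunP=> w.
have [m] := ubnP (n * n - ell w); elim: m => // m IH in w *; rewrite ltnS => dm.
pose asc (p : 'I_n * 'I_n) := (p.2 == p.1.+1 :> nat) && (w p.1 < w p.2)%N.
have [[i j] /andP[/= /eqP ji wij]|noasc] := pickP asc.
  have lt := ell_ascent ji wij; set v := comp_perm w (tperm i j) in lt.
  have vw : comp_perm v (tperm i j) = w by rewrite comp_perm_tpermK.
  have Hv : S v = T v.
    apply: IH; apply: leq_trans dm.
    by rewrite ltn_sub2l // (leq_trans lt) // ell_le.
  have lt' : (ell (comp_perm v (tperm i j)) < ell v)%N by rewrite vw.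
  by rewrite -vw (SD v i j ji lt') (TD v i j ji lt') Hv.
suff -> : w = w0 n by rewrite S0 T0.
have dec (i j : 'I_n) : j = i.+1 :> nat -> (w j < w i)%N.
  move=> ji; have := noasc (i, j); rewrite /asc /= ji eqxx /= ltnNge.
  move/negbFE; rewrite leq_eqVlt => /orP[/eqP/val_inj/perm_inj E|//].
  by move/eqP: ji; rewrite E ltn_eqF.
have up k (i : 'I_n) : i = k :> nat -> (w i + k < n)%N.
  elim: k i => [|k IHk] i ik; first by rewrite addn0.
  have kn : (k < n)%N by rewrite ltnW // -ik ltn_ord.
  have := IHk (Ordinal kn) erefl; apply: leq_trans.
  by rewrite addnS ltnS ltn_add2r; apply: dec.
have lo k (i : 'I_n) : (i + k.+1 = n)%N -> (k <= w i)%N.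
  elim: k i => [|k IHk] i ik //.
  have kn : (i.+1 < n)%N.
    apply: (@leq_trans (i + k.+2)); last by rewrite ik.
    by rewrite !addnS !ltnS leq_addr.
  apply: leq_ltn_trans (IHk (Ordinal kn) _) (dec i (Ordinal kn) erefl).
  by rewrite /= addSnnS.
apply/permP=> i; rewrite permE; apply/val_inj/anti_leq => /=.
apply/andP; split.
  by rewrite leq_subRL // addnC addnS up.
by apply: lo; rewrite -subSn ?subSS ?subnKC // ltnW.
Qed.

HB.lock Definition schubert n (w : 'S_n) : {mpoly int[n]} :=
  xchoose (schubert_family_ex n) w.

Lemma schubert_w0 n : schubert (w0 n) = \prod_(i < n) 'X_i ^+ (n.-1 - i).
Proof.
by rewrite unlock; case/schubert_familyP: (xchooseP (schubert_family_ex n)).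
Qed.

Lemma schubert_ddiff n (w : 'S_n) (i j : 'I_n) : j = i.+1 :> nat ->
  (ell (comp_perm w (tperm i j)) < ell w)%N ->
  schubert (comp_perm w (tperm i j)) = ddiff i j (schubert w).
Proof.
rewrite unlock.
case/schubert_familyP: (xchooseP (schubert_family_ex n)) => _ SD.
exact: SD.
Qed.

(** * Lattice path representations *)

(* The ring $\mathbb Z[x_1,x_2,\dots]$, as the monoid algebra of the free
   commutative monoid on [nat]; [Zvar i] is $x_{i+1}$. *)
Module PolyRing.
Import monalg.
Definition Zx : comNzRingType := {malg int[{cmonom nat}]}.
Definition Zvar (i : nat) : Zx := << ucm i >>.
End PolyRing.
Export PolyRing.

Definition to_Zx n (f : {mpoly int[n]}) : Zx :=
  mmap intr (fun i : 'I_n => Zvar i) f.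

Definition vertex : Type := (int * nat)%type.

(* A directed path is encoded by its starting vertex and the sequence of its
   steps: [false] for the edge $(a,b)\to(a,b+1)$ of weight $x_{b+1}$ and [true]
   for the edge $(a,b)\to(a-1,b+1)$ of weight 1. *)
Definition step (p : vertex) (d : bool) : vertex :=
  if d then (p.1 - 1, p.2.+1) else (p.1, p.2.+1).

Definition path_vertices (p : vertex) (s : seq bool) : seq vertex :=
  p :: scanl step p s.

Definition path_end (p : vertex) (s : seq bool) : vertex := foldl step p s.

Fixpoint path_weight (R : comNzRingType) (x : nat -> R) (p : vertex)
    (s : seq bool) : R :=
  if s is d :: s' then
    (if d then 1 else x p.2) * path_weight x (step p d) s'
  else 1.

(* A path from height 0 to height $c$ has exactly $c$ steps, so the paths under
   consideration have at most [max_height B] steps. *)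
Definition max_height k (B : 'I_k -> vertex) : nat := \max_(i < k) (B i).2.

Definition path_tuple k (B : 'I_k -> vertex) : finType :=
  {ffun 'I_k -> {bseq (max_height B) of bool}}.

Definition path_system k (a : 'I_k -> int) (B : 'I_k -> vertex) (s : 'S_k)
    (P : path_tuple B) : bool :=
  [forall i, path_end (a i, 0%N) (P i) == B (s i)] &&
  [forall i, forall j, (i != j) ==>
    ~~ has (mem (path_vertices (a i, 0%N) (P i)))
         (path_vertices (a j, 0%N) (P j))].

(* The permutation $\sigma(P)$ is determined by $P$, as vertex-disjoint paths
   have distinct ends; so this sums over $\mathscr P(A,B)$, grouped by
   $\sigma(P)$. *)
Definition lattice_sum (R : comNzRingType) (x : nat -> R) k (a : 'I_k -> int)
    (B : 'I_k -> vertex) : R :=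
  \sum_(s : 'S_k) \sum_(P : path_tuple B | path_system a s P)
    (-1) ^+ odd_perm s * \prod_(i < k) path_weight x (a i, 0%N) (P i).

Definition lattice_rep (F : Zx) k (a : 'I_k -> int) (B : 'I_k -> vertex) :
    Prop :=
  F = lattice_sum Zvar a B.

Definition proper_ends k (B : 'I_k -> vertex) : Prop :=
  injective (fun i => (B i).2).

Definition has_proper_lattice_rep (F : Zx) : Prop :=
  exists (k : nat) (a : 'I_k -> int) (B : 'I_k -> vertex),
    lattice_rep F a B /\ proper_ends B.

(* Main.v *)
Require Import Defs.
From HB Require Import structures.
From mathcomp Require Import all_boot all_order all_algebra all_fingroup.
From mathcomp Require Import mpoly.
From mathcomp Require Import zify ring.

Set Implicit Arguments.
Unset Strict Implicit.
Unset Printing Implicit Defensive.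

Import GRing.Theory.
Local Open Scope ring_scope.

(** The factorizations $w = uv$. A permutation $v$ avoids 132 and 312 exactly
    when each of its values is, at its position, a new maximum or a new minimum.
    Hence $u = w v^{-1}$ arises by reading the letters of $w$ and putting each of
    them at the left or at the right end of the word built so far, and the length
    condition says that the letters put at the left are left-to-right maxima of
    $w$. So a factorization amounts to a set $L$ of left-to-right maxima such that
    the word with $L$ in decreasing order followed by the other letters avoids
    1324, 2413 and 3142, which is a list of four conditions on $L$
    ([admissible]). Each of the 13 patterns forces a letter preceded by a larger
    one into $L$ ([admissible_avoids]); without them, the set of all left-to-right
    maxima that are not the 3 of a 13542 is admissible ([admissible_unblocked]).

    The representations. By the lemma of Lindstroem, Gessel and Viennot
    ([lattice_sum_det]), a lattice path representation is a determinant of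
    coefficients of polynomials $t^b (t+x_1)\cdots(t+x_c)$, one for each end
    $(b, c)$. A column of height $c$ is symmetric in all variables but $x_c$,
    $x_{c+1}$, so when the heights are distinct $\partial_c$ just lowers the end of
    height $c$ by one ([ddiff_coef_det]). It therefore suffices to write
    $\mathfrak S_u$ as a determinant with heights $0, \dots, n-1$: the letters of
    $v$ then lower ends one after the other, always into an empty height, until
    they rest at height 0 ([schubert_lowered]). A column of height 0 is a unit
    vector, and can be replaced by a unit vector coming from a large height, which
    makes the representation proper ([coef_det_lattice_rep]).

    The polynomial of $u$. For $w_0$ any bijective choice of the exponents $b$
    gives a triangular determinant, and when adjacent columns have exponents
    $\beta$ and $\beta+1$, a divided difference at them amounts to replacing both
    exponents by $\beta$ ([represented_desc]). These moves reach every permutation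
    avoiding 132, and every permutation avoiding 213. A permutation avoiding 2413
    and 3142 splits into blocks of positions, inverted with each other, that are
    direct sums; avoiding 1324 as well, each block is the direct sum of a part
    avoiding 132 and a part avoiding 213. Sorting one part or the other in every
    block gives $\alpha$, $\beta$ of the two kinds already treated, and sorting
    both gives $y$, with $\mathfrak S_u \mathfrak S_y = \mathfrak S_\alpha
    \mathfrak S_\beta$ ([schubert_product]); the determinants satisfy the same
    identity ([coef_det_exchange]), and $\mathfrak S_y \neq 0$ cancels. *)

(** * Occurrences of patterns *)

(** An occurrence is exhibited by listing its positions: they increase, and so
    do the values once the positions are listed in the order [index v p],
    [v = 1, 2, ...], of the entries of the pattern. *)
Lemma avoids_occ n (w : 'S_n) ps p (s : seq 'I_n) x0 :
  avoids w ps -> p \in ps -> size s = size p -> perm_eq p (iota 1 (size p)) ->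
  sorted ltn (map val s) ->
  sorted ltn [seq val (w (nth x0 s (index v p))) | v <- iota 1 (size p)] ->
  False.
Proof.
move=> avw pps ss pP s1 s2; apply: (avw p pps).
have up : uniq p by rewrite (perm_uniq pP) iota_uniq.
exists (fun c => nth x0 s c); split=> [a b ab|a b].
  have ltT := ltn_trans.
  have := sorted_ltn_nth ltT 0%N s1.
  move=> /(_ a b); rewrite !inE size_map ss !ltn_ord => /(_ isT isT ab).
  by rewrite !(nth_map x0) ?ss ?ltn_ord.
have half (c d : 'I_(size p)) : (nth 0 p c < nth 0 p d)%N ->
    (w (nth x0 s c) < w (nth x0 s d))%N.
  move=> cd; have ltT := ltn_trans.
  have pin (e : 'I_(size p)) : (0 < nth 0 p e <= size p)%N.
    have: nth 0%N p e \in p by rewrite mem_nth.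
    by rewrite (perm_mem pP) mem_iota; lia.
  have pd := pin d; have pc := pin c.
  have lt_pos i j : (i < j -> j < size p ->
      val (w (nth x0 s (index i.+1 p))) < val (w (nth x0 s (index j.+1 p))))%N.
    move=> ij jp; have := sorted_ltn_nth ltT 0%N s2.
    move=> /(_ i j); rewrite !inE size_map size_iota (ltn_trans ij jp) jp.
    move=> /(_ isT isT ij); rewrite !(nth_map 0%N) ?size_iota ?nth_iota //; lia.
  have := lt_pos (nth 0%N p c).-1 (nth 0%N p d).-1; rewrite !prednK; try lia.
  by rewrite !index_uniq //; apply; lia.
apply/idP/idP; last exact: half.
move=> lt; rewrite ltnNge; apply/negP; rewrite leq_eqVlt => /orP[|/half].
  by rewrite nth_uniq // => /eqP/val_inj E; rewrite E ltnn in lt.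
by rewrite ltnNge ltnW.
Qed.

Lemma contains_occ n (w : 'S_n) p :
  contains w p -> (0 < size p)%N -> perm_eq p (iota 1 (size p)) ->
  exists (x0 : 'I_n) (s : seq 'I_n), [/\ size s = size p, sorted ltn (map val s) &
    sorted ltn [seq val (w (nth x0 s (index v p))) | v <- iota 1 (size p)]].
Proof.
move=> [f [f_mono fP]] p_gt0 pP.
pose x0 := f (Ordinal p_gt0); exists x0, (codom f).
have fE i (ip : (i < size p)%N) : nth x0 (codom f) i = f (Ordinal ip).
  rewrite codomE (nth_map (Ordinal ip)) ?size_enum_ord //.
  by rewrite -[X in nth _ _ X]/(val (Ordinal ip)) nth_ord_enum.
rewrite size_codom card_ord; split=> //.
  apply/(sortedP 0%N) => i; rewrite size_map size_codom card_ord => ip.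
  rewrite !(nth_map x0) ?size_codom ?card_ord //; last exact: ltnW.
  by rewrite (fE _ ip) (fE _ (ltnW ip)); apply: f_mono.
apply/(sortedP 0%N) => i; rewrite size_map size_iota => ip.
have pin v : (0 < v <= size p)%N -> (index v p < size p)%N.
  by move=> vp; rewrite index_mem (perm_mem pP) mem_iota; lia.
have [iv jv] : (index i.+1 p < size p)%N /\ (index i.+2 p < size p)%N.
  by split; apply: pin; lia.
rewrite !(nth_map 0%N) ?size_iota ?nth_iota ?add1n //; try lia.
rewrite (fE _ iv) (fE _ jv); have := fP (Ordinal iv) (Ordinal jv).
by rewrite /= !nth_index -?index_mem // ltnSn.
Qed.

Ltac occ p s :=
  match goal with
  | H : avoids _ _ |- _ =>
    match s with
    | ?x :: _ => exfalso; apply: (@avoids_occ _ _ _ p s x H) => //=; lia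
    end
  end.

(** Equality of the two positions is dismissed, other comparisons in the context
    excluding it. *)
Ltac cmp_pos a b :=
  case: (ltngtP (nat_of_ord a) (nat_of_ord b)) => [?|?|/ord_inj ?];
  [ | | by subst b; lia].
Ltac cmp_val w a b :=
  case: (ltngtP (nat_of_ord (w a)) (nat_of_ord (w b)))
    => [?|?|/ord_inj/perm_inj ?];
  [ | | by subst b; lia].

(** * Left-to-right maxima brought to the front *)

Definition lrmax n (w : 'S_n) (x : 'I_n) : bool :=
  [forall k : 'I_n, (k < x)%N ==> (w k < w x)%N].

(** [x] is the entry 3 of an occurrence of 13542. Such an entry has to stay: its
    4, not being a left-to-right maximum, stays behind it, so that bringing [x] to
    the front would form a 3142 with the entries 1, 4 and 2. *)
Definition blocked n (w : 'S_n) (x : 'I_n) : bool :=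
  [exists a : 'I_n, [exists m : 'I_n, [exists y : 'I_n, [exists z : 'I_n,
    [&& a < x, x < m, m < y & y < z]%N &&
    [&& w a < w z, w z < w x, w x < w y & w y < w m]%N]]]].

Lemma lrmaxP n (w : 'S_n) (x : 'I_n) :
  reflect (forall k : 'I_n, (k < x -> w k < w x)%N) (lrmax w x).
Proof. by apply: (iffP forallP) => H k; [apply/implyP | apply/implyP/H]. Qed.

Lemma lrmaxPn n (w : 'S_n) (x : 'I_n) :
  reflect (exists2 M : 'I_n, M < x & w x < w M)%N (~~ lrmax w x).
Proof.
apply: (iffP forallPn) => -[M].
  rewrite negb_imply -leqNgt => /andP[Mx]; rewrite leq_eqVlt.
  case/orP=> [|wM]; last by exists M.
  by move=> /eqP/ord_inj/perm_inj E; subst; lia.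
by move=> Mx wM; exists M; rewrite Mx /= -leqNgt ltnW.
Qed.

Lemma blockedP n (w : 'S_n) (x : 'I_n) :
  reflect (exists a m y z : 'I_n,
    [/\ a < x, x < m, m < y & y < z]%N /\
    [/\ w a < w z, w z < w x, w x < w y & w y < w m]%N) (blocked w x).
Proof.
apply: (iffP existsP).
  move=> [a /existsP[m /existsP[y /existsP[z /andP[/and4P A /and4P B]]]]].
  by exists a, m, y, z.
move=> [a [m [y [z [/and4P A /and4P B]]]]]; exists a; apply/existsP; exists m.
by apply/existsP; exists y; apply/existsP; exists z; rewrite A B.
Qed.

Definition patterns13 : seq (seq nat) :=
  [:: [:: 5; 1; 3; 2; 4]; [:: 1; 5; 3; 2; 4];
    [:: 5; 2; 4; 1; 3]; [:: 2; 5; 4; 1; 3]; [:: 5; 3; 1; 4; 2];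
    [:: 3; 5; 1; 4; 2]; [:: 3; 1; 5; 4; 2];
    [:: 1; 4; 3; 2; 6; 5]; [:: 1; 4; 3; 6; 2; 5]; [:: 1; 4; 3; 6; 5; 2];
    [:: 1; 4; 6; 3; 5; 2]; [:: 4; 1; 3; 2; 6; 5]; [:: 4; 1; 3; 6; 2; 5]]%N.

(** The word made of [L] in decreasing order, then of the other entries in their
    order, avoids 1324, 2413 and 3142. An occurrence uses at most two entries of
    [L], at its beginning; tracing it back to [w] gives the last four conditions,
    the letters naming the entries of the occurrence in [w]. In the last one, the
    entry [x] moved before [c] would complete a 3142. *)
Record admissible n (w : 'S_n) (L : {set 'I_n}) : Prop := Admissible {
  adm_lrmax : forall x, x \in L -> lrmax w x;
  adm_1324 : forall p x q t : 'I_n, (p < x -> x < q -> q < t ->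
    w p < w q -> w q < w x -> w x < w t -> x \in L \/ t \in L)%N;
  adm_2413 : forall p q r s : 'I_n, (p < q -> q < r -> r < s ->
    w r < w p -> w p < w s -> w s < w q -> q \in L)%N;
  adm_3142 : forall p r q s : 'I_n, (p < r -> r < q -> q < s ->
    w r < w s -> w s < w p -> w p < w q -> q \in L)%N;
  adm_1342 : forall c x r d : 'I_n, (c < x -> x < r -> r < d ->
    w c < w d -> w d < w x -> w x < w r -> x \in L -> r \in L)%N }.

Section Sufficiency.
Variables (n : nat) (w : 'S_n).
Hypothesis avw : avoids w patterns13.
Implicit Types p q r s t a m y z c d x M : 'I_n.

Lemma lrmax_2413 p q r s : (p < q -> q < r -> r < s ->
  w r < w p -> w p < w s -> w s < w q -> lrmax w q)%N.
Proof.
move=> pq qr rs rp ps sq; apply: contraT => /lrmaxPn[M Mq qM].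
cmp_pos p M; first by occ [:: 2; 5; 4; 1; 3]%N [:: p; M; q; r; s].
by occ [:: 5; 2; 4; 1; 3]%N [:: M; p; q; r; s].
Qed.

Lemma lrmax_3142 p r q s : (p < r -> r < q -> q < s ->
  w r < w s -> w s < w p -> w p < w q -> lrmax w q)%N.
Proof.
move=> pr rq qs rs sp pq; apply: contraT => /lrmaxPn[M Mq qM].
cmp_pos p M; last by occ [:: 5; 3; 1; 4; 2]%N [:: M; p; r; q; s].
cmp_pos r M; first by occ [:: 3; 1; 5; 4; 2]%N [:: p; r; M; q; s].
by occ [:: 3; 5; 1; 4; 2]%N [:: p; M; r; q; s].
Qed.

(** Between the 3 and the 4 of a 13542 all entries exceed the 3. Hence a pattern
    that uses the blocked entry can be moved on to this 4, which has a larger entry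
    before it. *)
Lemma blocked_gap a x m y z q :
  (a < x -> x < m -> m < y -> y < z ->
   w a < w z -> w z < w x -> w x < w y -> w y < w m ->
   x < q -> q < y -> w x < w q)%N.
Proof.
move=> ax xm my yz az zx xy ym xq qy; cmp_val w x q; first by [].
cmp_pos q m; cmp_val w q z.
- by occ [:: 3; 1; 5; 4; 2]%N [:: x; q; m; y; z].
- by occ [:: 1; 4; 3; 6; 5; 2]%N [:: a; x; q; m; y; z].
- by occ [:: 3; 5; 1; 4; 2]%N [:: x; m; q; y; z].
by occ [:: 1; 4; 6; 3; 5; 2]%N [:: a; x; m; q; y; z].
Qed.

(** The condition on 1324 leaves the choice between the 3 and the 4. If the 3 is
    excluded by a larger entry before it, then the 4 is available: a reason to
    exclude it as well would complete one of the patterns. *)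
Lemma unblocked_1324 p x q t M :
  (p < x -> x < q -> q < t -> w p < w q -> w q < w x -> w x < w t ->
   M < x -> w x < w M -> lrmax w t && ~~ blocked w t)%N.
Proof.
move=> px xq qt pq' qx' xt' Mx xM; apply: contraT; rewrite negb_and negbK.
have tM : (w t < w M)%N -> False.
  move=> tM; cmp_pos p M; first by occ [:: 1; 5; 3; 2; 4]%N [:: p; M; x; q; t].
  by occ [:: 5; 1; 3; 2; 4]%N [:: M; p; x; q; t].
cmp_val w M t; last by case: (tM _).
move=> /orP[/lrmaxPn[N Nt tN]|/blockedP[a [m [y [z [[? ? ? ?] [? ? ? ?]]]]]]].
- cmp_pos x N; last first.
    cmp_pos p N; first by occ [:: 1; 5; 3; 2; 4]%N [:: p; N; x; q; t].
    by occ [:: 5; 1; 3; 2; 4]%N [:: N; p; x; q; t].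
  cmp_pos p M; cmp_pos q N.
  + by occ [:: 1; 4; 3; 2; 6; 5]%N [:: p; M; x; q; N; t].
  + by occ [:: 1; 4; 3; 6; 2; 5]%N [:: p; M; x; N; q; t].
  + by occ [:: 4; 1; 3; 2; 6; 5]%N [:: M; p; x; q; N; t].
  by occ [:: 4; 1; 3; 6; 2; 5]%N [:: M; p; x; N; q; t].
cmp_pos p M.
  by occ [:: 1; 4; 3; 2; 6; 5]%N [:: p; M; x; q; m; y].
by occ [:: 4; 1; 3; 2; 6; 5]%N [:: M; p; x; q; m; y].
Qed.

(** The largest candidate works: the conditions on 1324, 2413 and 3142 only ask
    for entries in [L], and a left-to-right maximum excluded by the condition on
    1342 is blocked. *)
Lemma admissible_unblocked :
  admissible w [set x | lrmax w x && ~~ blocked w x].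
Proof.
split=> [x|p x q t px xq qt pq' qx' xt'|p q r s pq qr rs rp' ps' sq'
  |p r q s pr rq qs rs' sp' pq'|c x r d cx xr rd cd' dx' xr']; rewrite !inE.
- by case/andP.
- have [/= _|/lrmaxPn[M Mx xM]] := boolP (lrmax w x); last first.
    by right; apply: (@unblocked_1324 p x q t M).
  have [/blockedP|] := boolP (blocked w x); last by left.
  move=> [a [m [y [z [[ax xm my yz] [az' zx' xy' ym']]]]]]; right.
  cmp_pos q y.
    by have := blocked_gap ax xm my yz az' zx' xy' ym' xq; lia.
  cmp_val w t y; first by occ [:: 2; 5; 4; 1; 3]%N [:: x; m; y; q; t].
  by apply: (@unblocked_1324 p y q t m); lia.
- rewrite (lrmax_2413 pq qr rs) //=; apply/blockedP.
  move=> [a [m [y [z [[aq qm my yz] [az' zq' qy' ym']]]]]].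
  cmp_pos r y; last by occ [:: 2; 5; 4; 1; 3]%N [:: p; m; y; r; s].
  by have := blocked_gap aq qm my yz az' zq' qy' ym' qr; lia.
- rewrite (lrmax_3142 pr rq qs) //=; apply/blockedP.
  move=> [a [m [y [z [[aq qm my yz] [az' zq' qy' ym']]]]]].
  cmp_pos s y; last by occ [:: 3; 1; 5; 4; 2]%N [:: p; r; m; y; s].
  by have := blocked_gap aq qm my yz az' zq' qy' ym' qs; lia.
move=> /andP[/lrmaxP xmax xub].
have block a m y z : (a < x -> x < m -> m < y -> y < z ->
    w a < w z -> w z < w x -> w x < w y -> w y < w m -> False)%N.
  by move=> *; case/negP: xub; apply/blockedP; exists a, m, y, z.
have [/= _|/lrmaxPn[M Mr rM]] := boolP (lrmax w r); last first.
  cmp_pos M x; first by have := xmax M; lia.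
  by case: (block c M r d); lia.
apply/blockedP => - [a [m [y [z [[ar rm my yz] [az' zr' ry' ym']]]]]].
cmp_pos d y; last by case: (block c m y d); lia.
by have := blocked_gap ar rm my yz az' zr' ry' ym' rd; lia.
Qed.

End Sufficiency.

(** In each case some entry is forced into [L] by the occurrence, but is preceded by
    a larger entry of the occurrence. *)
Lemma admissible_avoids n (w : 'S_n) L : admissible w L -> avoids w patterns13.
Proof.
case=> Lmax L1324 L2413 L3142 L1342 p pin wp.
have max x (k : 'I_n) : x \in L -> (k < x -> w k < w x)%N.
  by move=> xL; apply/lrmaxP/Lmax.
have [||x0 [s [ss s1 s2]]] := contains_occ wp.
- by move: pin; rewrite !inE; do !case/orP=> [|]; move/eqP->.
- by move: pin; rewrite !inE; do !case/orP=> [|]; move/eqP->.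
move: pin ss s1 s2 {wp}.
rewrite !inE; do !case/orP=> [|]; move/eqP-> => /=.
all: case: s => [|a [|b [|c [|d [|e [|g [|? ?]]]]]]] //= _ s1 s2.
- by case: (L1324 b c d e); try lia; move/(max _ a); lia.
- by case: (L1324 a c d e); try lia; move/(max _ b); lia.
- have cL : c \in L by apply: (L2413 b c d e); lia.
  by have := max c a cL; lia.
- have cL : c \in L by apply: (L2413 a c d e); lia.
  by have := max c b cL; lia.
- have dL : d \in L by apply: (L3142 b c d e); lia.
  by have := max d a dL; lia.
- have dL : d \in L by apply: (L3142 a c d e); lia.
  by have := max d b dL; lia.
- have dL : d \in L by apply: (L3142 a b d e); lia.
  by have := max d c dL; lia.
- by case: (L1324 a c d g); try lia; [move/(max _ b) | move/(max _ e)]; lia.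
- by case: (L1324 a c e g); try lia; [move/(max _ b) | move/(max _ d)]; lia.
- have [//|//|//|//|//|//|bL|eL] := L1324 a b c e; try lia; last first.
    by have := max e d eL; lia.
  have eL : e \in L by apply: (L1342 a b e g) => //; lia.
  by have := max e d eL; lia.
- have [//|//|//|//|//|//|bL|eL] := L1324 a b d e; try lia; last first.
    by have := max e c eL; lia.
  have eL : e \in L by apply: (L1342 a b e g) => //; lia.
  by have := max e c eL; lia.
- by case: (L1324 b c d g); try lia; [move/(max _ a) | move/(max _ e)]; lia.
by case: (L1324 b c e g); try lia; [move/(max _ a) | move/(max _ d)]; lia.
Qed.

(** * Permutations from orders, and lengths of products *)

Lemma perm_of_key n (k : 'I_n -> nat) : injective k ->
  exists p : 'S_n, forall i j, (p i < p j)%N = (k i < k j)%N.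
Proof.
move=> k_inj; pose D i := [set j | (k j < k i)%N].
have D_lt i : (#|D i| < n)%N.
  rewrite -[X in (_ < X)%N](card_ord n) -cardsT.
  apply/proper_card/properP; split=> //.
  by exists i; rewrite !inE ?ltnn.
have D_mono i j : (k i < k j)%N -> (#|D i| < #|D j|)%N.
  move=> ij; apply/proper_card/properP; split; last by exists i; rewrite !inE ?ltnn.
  by apply/subsetP => l; rewrite !inE => /ltn_trans; apply.
have f_inj : injective (fun i => Ordinal (D_lt i)).
  move=> i j /(congr1 val) /= E; apply: k_inj.
  by case: (ltngtP (k i) (k j)) => [/D_mono|/D_mono|//]; rewrite E ltnn.
exists (perm f_inj) => i j; rewrite !permE /=.
case: (ltngtP (k i) (k j)) => [/D_mono -> //|/D_mono|/k_inj ->].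
  by case: ltngtP.
by rewrite ltnn.
Qed.

Lemma perm_lt_neq n (x : 'S_n) (i j : 'I_n) : i != j ->
  (x i < x j)%N = ~~ (x j < x i)%N.
Proof. by move=> ij; rewrite -leqNgt ltn_neqAle val_eqE (inj_eq perm_inj) ij. Qed.

Lemma perm_lt_inj n (p q : 'S_n) :
  (forall i j : 'I_n, (i < j)%N -> (p i < p j)%N = (q i < q j)%N) -> p = q.
Proof.
move=> pq; have {}pq (i j : 'I_n) : (p i < p j)%N = (q i < q j)%N.
  have [->|ij] := eqVneq i j; first by rewrite !ltnn.
  move: (ij); rewrite -val_eqE neq_ltn => /orP[/pq //|/pq].
  by rewrite !(perm_lt_neq _ ij) => ->.
have val_card (x : 'S_n) i : val (x i) = #|[set j | (x j < x i)%N]|.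
  have -> : [set j | (x j < x i)%N] = x @^-1: [set a : 'I_n | (a < x i)%N].
    by apply/setP=> j; rewrite !inE.
  rewrite card_preimset; last exact: perm_inj.
  rewrite -sum1_card (eq_bigl (fun a : 'I_n => a < x i)%N); last first.
    by move=> a; rewrite inE.
  by rewrite -(big_ord_widen n (fun=> 1%N)) ?sum1_card ?card_ord // ltnW.
apply/permP=> i; apply/val_inj; rewrite (val_card p) (val_card q).
apply: eq_card => j.
by rewrite !inE pq.
Qed.

Definition discord n (x : 'S_n) : {set 'I_n * 'I_n} :=
  [set p : 'I_n * 'I_n | (p.1 < p.2)%N != (x p.1 < x p.2)%N].

(** Symmetrization of a set of pairs: lengths are compared below by counting
    unordered pairs, on which permutations act. *)
Definition symset n (I : {set 'I_n * 'I_n}) : {set 'I_n * 'I_n} :=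
  I :|: [set p | (p.2, p.1) \in I].

Lemma card_symset n (I : {set 'I_n * 'I_n}) :
  I \subset [set p : 'I_n * 'I_n | (p.1 < p.2)%N] -> #|symset I| = (#|I|).*2.
Proof.
move=> /subsetP lt; pose sw (p : 'I_n * 'I_n) := (p.2, p.1).
have sw_inj : injective sw by move=> [a b] [c d] [-> ->].
have -> : symset I = I :|: sw @^-1: I by apply/setP=> p; rewrite !inE.
rewrite cardsU card_preimset // -addnn.
suff -> : I :&: sw @^-1: I = set0 by rewrite cards0 subn0.
apply/setP=> -[i j]; rewrite !inE /=; apply/andP => -[/lt + /lt].
by rewrite !inE /=; lia.
Qed.

Lemma discordE n (x : 'S_n) : discord x = symset (inversions x).
Proof.
apply/setP=> -[i j]; rewrite !inE /=.
have [->|ij] := eqVneq i j; first by rewrite !ltnn.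
rewrite (perm_lt_neq x ij); move: ij; rewrite -val_eqE /=.
by case: ltngtP; case: (x j < x i)%N.
Qed.

(** [u] inverts the positions [v i] and [v j] when exactly one of [v] and [uv]
    inverts [i] and [j]. *)
Lemma ell_comp_perm n (u v : 'S_n) :
  (ell u + #|inversions v :&: inversions (comp_perm u v)|.*2 =
   ell v + ell (comp_perm u v))%N.
Proof.
set w := comp_perm u v.
have up (x : 'S_n) : inversions x \subset [set p : 'I_n * 'I_n | (p.1 < p.2)%N].
  by apply/subsetP => p; rewrite !inE => /andP[].
pose g (p : 'I_n * 'I_n) := (v p.1, v p.2).
have g_inj : injective g by move=> [a b] [c d] [/perm_inj -> /perm_inj ->].
have : #|g @^-1: discord u| = (ell u).*2.
  by rewrite card_preimset // discordE card_symset.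
have -> : g @^-1: discord u =
    (discord v :\: discord w) :|: (discord w :\: discord v).
  apply/setP=> -[i j]; rewrite !inE /= /w !comp_permE.
  by case: (i < j)%N; case: (v i < v j)%N; case: (u _ < u _)%N.
have -> : #|(discord v :\: discord w) :|: (discord w :\: discord v)| =
    (#|discord v :\: discord w| + #|discord w :\: discord v|)%N.
  rewrite cardsU (_ : _ :&: _ = set0) ?cards0 ?subn0 //.
  by apply/setP=> p; rewrite !in_setI !in_setD in_set0; do 2!case: (p \in _).
have symI : discord v :&: discord w = symset (inversions v :&: inversions w).
  rewrite !discordE; apply/setP=> -[i j]; rewrite !inE /=.
  by case: ltngtP; rewrite ?orbF.
have cI : #|discord v :&: discord w| = (#|inversions v :&: inversions w|).*2.
  by rewrite symI card_symset // subIset ?up.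
have cx (x : 'S_n) : #|discord x| = (ell x).*2 by rewrite discordE card_symset.
have := cardsID (discord w) (discord v); rewrite cI cx => Dv.
have := cardsID (discord v) (discord w); rewrite setIC cI cx => Dw.
by move: (#|_ :\: _|) (#|_ :\: _|) Dv Dw => a b; lia.
Qed.

(** * Factorizations as admissible sets of left-to-right maxima *)

(** The positions whose letters go to the front in $u = w v^{-1}$. *)
Definition prefix_minima n (v : 'S_n) : {set 'I_n} :=
  [set i : 'I_n | [forall k : 'I_n, (k < i)%N ==> (v i < v k)%N]].

Lemma prefix_minimaP n (v : 'S_n) (i k : 'I_n) :
  i \in prefix_minima v -> (k < i -> v i < v k)%N.
Proof. by rewrite inE => /forallP/(_ k)/implyP. Qed.

Lemma notin_prefix_minima n (v : 'S_n) (i k : 'I_n) :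
  avoids v [:: [:: 1; 3; 2]; [:: 3; 1; 2]]%N ->
  i \notin prefix_minima v -> (k < i -> v k < v i)%N.
Proof.
move=> avv; rewrite inE => /forallPn[j].
rewrite negb_imply -leqNgt => /andP[ji vji] ki.
cmp_val v k i; first by [].
cmp_val v j i; last by lia.
cmp_pos j k; last by occ [:: 3; 1; 2]%N [:: k; j; i].
by occ [:: 1; 3; 2]%N [:: j; k; i].
Qed.

(** Lengths subtract exactly when no pair is inverted both in [v] and in [w]; as
    the letters at the prefix minima of [v] pass all the earlier ones, they are
    left-to-right maxima of [w]. *)
Lemma factorization_admissible n (u v : 'S_n) (w := comp_perm u v) :
  avoids u [:: [:: 1; 3; 2; 4]; [:: 2; 4; 1; 3]; [:: 3; 1; 4; 2]]%N ->
  avoids v [:: [:: 1; 3; 2]; [:: 3; 1; 2]]%N ->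
  (ell w + ell v = ell u)%N ->
  admissible w (prefix_minima v).
Proof.
move=> avu avv ell_uv.
have noinv (i j : 'I_n) : (i < j -> v j < v i -> w i < w j)%N.
  move=> ij ji; have /eqP : #|inversions v :&: inversions w| = 0%N.
    by have := ell_comp_perm u v; rewrite -/w; lia.
  rewrite cards_eq0 => /eqP/setP/(_ (i, j)); rewrite !inE /= ij ji /=.
  by rewrite (perm_lt_neq w) -?val_eqE /=; lia.
set L := prefix_minima v.
have Lmax (i k : 'I_n) : i \in L -> (k < i -> w k < w i)%N.
  by move=> iL ki; apply: noinv => //; apply: prefix_minimaP iL ki.
have notL (i k : 'I_n) : (k < i -> w i < w k -> i \notin L)%N.
  by move=> ki wik; apply/negP => /(Lmax _ k)/(_ ki); lia.
have R (i k : 'I_n) : i \notin L -> (k < i -> v k < v i)%N.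
  exact: notin_prefix_minima.
have wE i : w i = u (v i) by rewrite comp_permE.
split=> [x|p x q t|p q r s|p r q s|c x r d].
- by move=> xL; apply/lrmaxP => k; apply: Lmax.
- move=> px xq qt pq' qx' xt'; have qL := notL q x xq qx'.
  have [|xL] := boolP (x \in L); first by left.
  have [|tL] := boolP (t \in L); first by right.
  have {}px := R _ _ xL px; have {}xq := R _ _ qL xq.
  have {}qt := R _ _ tL qt; rewrite !wE in pq' qx' xt'.
  by occ [:: 1; 3; 2; 4]%N [:: v p; v x; v q; v t].
- move=> pq qr rs rp' ps' sq'; apply: contraT => qL.
  have rL : r \notin L by apply: (notL r q); lia.
  have sL : s \notin L by apply: (notL s q); lia.
  have {}pq := R _ _ qL pq; have {}qr := R _ _ rL qr.
  have {}rs := R _ _ sL rs; rewrite !wE in rp' ps' sq'.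
  by occ [:: 2; 4; 1; 3]%N [:: v p; v q; v r; v s].
- move=> pr rq qs rs' sp' pq'; apply: contraT => qL.
  have rL : r \notin L by apply: (notL r p); lia.
  have sL : s \notin L by apply: (notL s p); lia.
  have {}pr := R _ _ rL pr; have {}rq := R _ _ qL rq.
  have {}qs := R _ _ sL qs; rewrite !wE in rs' sp' pq'.
  by occ [:: 3; 1; 4; 2]%N [:: v p; v r; v q; v s].
move=> cx xr rd cd' dx' xr' xL; apply: contraT => rL.
have dL : d \notin L by apply: (notL d x); lia.
have xc := prefix_minimaP xL cx; have cr := R r c rL ltac:(lia).
have {}rd := R _ _ dL rd; rewrite !wE in cd' dx' xr'.
by occ [:: 3; 1; 4; 2]%N [:: v x; v c; v r; v d].
Qed.

(** The key orders the letters of [L] backwards, before all the others. *)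
Lemma admissible_factorization n (w : 'S_n) L : admissible w L ->
  exists u v : 'S_n, [/\ w = comp_perm u v,
    avoids u [:: [:: 1; 3; 2; 4]; [:: 2; 4; 1; 3]; [:: 3; 1; 4; 2]]%N,
    avoids v [:: [:: 1; 3; 2]; [:: 3; 1; 2]]%N
    & (ell (comp_perm u v) + ell v = ell u)%N].
Proof.
case=> Lmax L1324 L2413 L3142 L1342.
pose key (i : 'I_n) := (if i \in L then n - i else n + i.+1)%N.
have key_inj : injective key.
  move=> i j; rewrite /key; have := ltn_ord i; have := ltn_ord j => jn iN.
  by case: ifP; case: ifP => _ _ E; apply: ord_inj; lia.
have [v vE] := perm_of_key key_inj.
pose u := comp_perm w (v^-1)%g.
have uv : comp_perm u v = w by rewrite /comp_perm mulgA mulgV mul1g.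
have max (k x : 'I_n) : x \in L -> (k < x -> w k < w x)%N.
  by move=> /Lmax/lrmaxP; apply.
have after (a b : 'I_n) : (key a < key b -> w a < w b -> b \notin L)%N.
  move=> + wab; apply: contraTN => bL; rewrite /key bL -leqNgt.
  case: ifP => [aL|_]; last by have := ltn_ord b; lia.
  by have := max b a aL; have := ltn_ord b; lia.
have lastR (a b : 'I_n) : (b \notin L -> key a < key b -> w a < w b -> a < b)%N.
  move=> bL; rewrite /key (negPf bL); case: ifP => [aL _ wab|_]; last by lia.
  cmp_pos a b; first by []; by have := max b a aL; lia.
have keyR (a b : 'I_n) : (b \notin L -> key b < key a -> (a \notin L) && (b < a))%N.
  move=> bL; rewrite /key (negPf bL); case: ifP => _ /=; last by lia.
  by have := ltn_ord b; lia.
have avu : avoids u [:: [:: 1; 3; 2; 4]; [:: 2; 4; 1; 3]; [:: 3; 1; 4; 2]]%N.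
  move=> p pin up.
  have [||x0 [s [ss s1 s2]]] := contains_occ up.
  - by move: pin; rewrite !inE; do !case/orP=> [|]; move/eqP->.
  - by move: pin; rewrite !inE; do !case/orP=> [|]; move/eqP->.
  have [t tE] : exists t, s = map v t.
    exists (map (v^-1)%g s); rewrite -map_comp map_id_in // => i _ /=.
    by rewrite permKV.
  have uE i : u (v i) = w i by rewrite comp_permE permK.
  move: pin ss s1 s2; rewrite tE !inE {s tE up}.
  do !case/orP=> [|]; move/eqP-> => /=;
    case: t => [|a [|b [|c [|d [|? ?]]]]] //= _; rewrite !vE !uE => s1 s2.
  - have bL := after a b ltac:(lia) ltac:(lia).
    have /andP[cL bc] := keyR c b bL ltac:(lia).
    have /andP[dL cd] := keyR d c cL ltac:(lia).
    have ab := lastR a b bL ltac:(lia) ltac:(lia).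
    by case: (L1324 a b c d); lia.
  - have bL := after a b ltac:(lia) ltac:(lia).
    have /andP[cL bc] := keyR c b bL ltac:(lia).
    have /andP[dL cd] := keyR d c cL ltac:(lia).
    have ab := lastR a b bL ltac:(lia) ltac:(lia).
    by move: bL; rewrite (L2413 a b c d) //; lia.
  have cL := after a c ltac:(lia) ltac:(lia).
  have /andP[dL cd] := keyR d c cL ltac:(lia).
  have ac := lastR a c cL ltac:(lia) ltac:(lia).
  have bc := lastR b c cL ltac:(lia) ltac:(lia).
  cmp_pos a b; first by move: cL; rewrite (L3142 a b c d) //; lia.
  have aL : a \in L.
    by have : (key a < key b)%N by [lia]; rewrite /key; do 2!case: ifP; lia.
  by move: cL; rewrite (L1342 b a c d) //; lia.
exists u, v; split; rewrite ?uv //.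
  move=> p pin vp.
  have [||x0 [t [tt t1 t2]]] := contains_occ vp.
  - by move: pin; rewrite !inE; do !case/orP=> [|]; move/eqP->.
  - by move: pin; rewrite !inE; do !case/orP=> [|]; move/eqP->.
  move: pin tt t1 t2; rewrite !inE; do !case/orP=> [|]; move/eqP-> => /=;
    case: t => [|a [|b [|c [|? ?]]]] //= _; rewrite !vE /key;
    by do 3!case: ifP; lia.
have := ell_comp_perm u v; rewrite uv.
suff -> : inversions v :&: inversions w = set0 by rewrite cards0; lia.
apply/setP=> -[i j]; rewrite !inE /= vE; apply/andP=> -[/andP[ij]].
rewrite /key ij /=; case: ifP => [jL _|jL]; first by have := max i j jL ij; lia.
by case: ifP => _; lia.
Qed.

(** * Lattice paths and determinants *)

(** The coefficient of ['X^a] in ['X^b * lattice_poly x c] is the total weight of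
    the paths from [(a, 0)] to [(b, c)]: the factor ['X + x_m] stands for the two
    edges leaving the height [m]. *)
HB.lock Definition lattice_poly (R : comNzRingType) (x : nat -> R) (c : nat) :
  {poly R} :=
  \prod_(m < c) ('X + (x m)%:P).

Lemma lattice_polyE (R : comNzRingType) (x : nat -> R) c :
  lattice_poly x c = \prod_(m < c) ('X + (x m)%:P).
Proof. by rewrite unlock. Qed.

Lemma path_endE (p : vertex) s :
  path_end p s = (p.1 - (count id s)%:Z, (p.2 + size s)%N).
Proof.
elim: s p => [|d s IH] [a b] /=; first by rewrite subr0 addn0.
rewrite -/(path_end _ s) IH; case: d => /=; congr (_, _); lia.
Qed.

Lemma path_end_cat (p : vertex) s t :
  path_end p (s ++ t) = path_end (path_end p s) t.
Proof. exact: foldl_cat. Qed.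

Lemma mem_path_vertices (p v : vertex) s :
  reflect (exists2 m, (m <= size s)%N & v = path_end p (take m s))
          (v \in path_vertices p s).
Proof.
apply: (iffP (nthP p)) => [[m]|[m ms ->]].
  rewrite [size _]/= size_scanl ltnS => ms <-; exists m => //.
  by rewrite nth_cons_scanl.
by exists m; rewrite ?nth_cons_scanl //= size_scanl ltnS.
Qed.

Lemma path_weight_cat (R : comNzRingType) (x : nat -> R) (p : vertex) s t :
  path_weight x p (s ++ t) = path_weight x p s * path_weight x (path_end p s) t.
Proof. by elim: s p => [|d s IH] p /=; rewrite ?mul1r // IH mulrA. Qed.

Lemma path_weight_tuples (R : comNzRingType) (x : nat -> R) (a : int) b c :
  \sum_(t : c.-tuple bool) path_weight x (a, b) t *: 'X^(count id t) =
  \prod_(m < c) ('X + (x (b + m)%N)%:P).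
Proof.
elim: c a b => [|c IH] a b.
  rewrite big_ord0 (big_pred1 [tuple]) /= ?scale1r ?expr0 // => t.
  by apply/esym/eqP/val_inj; case: t => -[].
rewrite big_ord_recl /= addn0 (reindex (fun p : bool * c.-tuple bool =>
  cons_tuple p.1 p.2)) /=; last first.
  exists (fun t => (thead t, [tuple of behead t])) => [[d t] _|t _] /=.
    by congr (_, _); apply/val_inj.
  by rewrite [t in RHS]tuple_eta; apply/val_inj.
rewrite -(pair_bigA _ (fun d (t : c.-tuple bool) =>
  path_weight x (a, b) (d :: t) *: 'X^(count id (d :: t)))) /=.
rewrite !big_bool /= mulrDl; congr (_ + _).
  under eq_bigr do rewrite mul1r add1n exprS scalerAr.
  rewrite -mulr_sumr IH; congr (_ * _).
  by apply: eq_bigr => i _; rewrite addSnnS.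
under eq_bigr do rewrite add0n -scalerA.
rewrite -scaler_sumr IH mul_polyC; congr (_ *: _).
by apply: eq_bigr => i _; rewrite addSnnS.
Qed.

Lemma path_weight_sum (R : comNzRingType) (x : nat -> R) H (a b c : nat) :
  (c <= H)%N ->
  \sum_(s : {bseq H of bool} | path_end (a%:Z, 0%N) s == (b%:Z, c))
    path_weight x (a%:Z, 0%N) s = ('X^b * lattice_poly x c)`_a.
Proof.
move=> cH; rewrite coefXnM lattice_polyE.
have -> : \prod_(m < c) ('X + (x m)%:P) =
    \sum_(t : c.-tuple bool) path_weight x (a%:Z, 0%N) t *: 'X^(count id t).
  by rewrite path_weight_tuples; apply: eq_bigr.
rewrite coef_sum.
under [in RHS]eq_bigr do rewrite coefZ coefXn.
have -> : (if (a < b)%N then 0 else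
    \sum_(t : c.-tuple bool) path_weight x (a%:Z, 0%N) t *
       ((a - b)%N == count id t)%:R) =
  \sum_(t : c.-tuple bool | (b + count id t)%N == a) path_weight x (a%:Z, 0%N) t.
  rewrite [in RHS]big_mkcond /=; case: ifP => ab.
    by rewrite big1 // => t _; case: eqP => // E; lia.
  apply: eq_bigr => t _.
  rewrite (_ : (_ == _) = (b + count id t == a)%N); last by lia.
  by case: eqP; rewrite (mulr0, mulr1).
pose up (t : c.-tuple bool) : {bseq H of bool} := widen_bseq cH t.
pose dn (s : {bseq H of bool}) : c.-tuple bool :=
  insubd [tuple of nseq c false] (s : seq bool).
have PE (s : {bseq H of bool}) : (path_end (a%:Z, 0%N) s == (b%:Z, c)) =
   (size s == c) && ((b + count id s)%N == a).
  by rewrite path_endE /= xpair_eqE add0n; lia.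
have szdn (s : {bseq H of bool}) : size s == c -> dn s = s :> seq bool.
  by move=> sc; rewrite /dn val_insubd sc.
rewrite (reindex_onto up dn); last first.
  by move=> s; rewrite PE => /andP[sc _]; apply/val_inj; rewrite /= szdn.
apply: eq_big => // t; rewrite PE /= size_tuple eqxx /=.
rewrite (_ : dn (up t) == t) ?andbT //; apply/eqP/val_inj.
by rewrite /= szdn // size_tuple.
Qed.

Section TailSwap.
Variables (R : comNzRingType) (x : nat -> R) (k : nat).
Variables (a : 'I_k -> int) (B : 'I_k -> vertex).
Implicit Types (P : path_tuple B) (ij : 'I_k * 'I_k) (m : nat).

Let start (i : 'I_k) : vertex := (a i, 0%N).

(** As all paths start at height 0 and every edge goes up by one, two paths can
    only meet after the same number [m] of steps. *)
Definition meet P m ij : bool :=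
  [&& ij.1 != ij.2, (m <= size (P ij.1))%N, (m <= size (P ij.2))%N &
    path_end (start ij.1) (take m (P ij.1)) ==
    path_end (start ij.2) (take m (P ij.2))].

Definition disjoint_paths P : bool :=
  [forall i, forall j, (i != j) ==>
    ~~ has (mem (path_vertices (start i) (P i))) (path_vertices (start j) (P j))].

Lemma not_disjointP P :
  reflect (exists m ij, meet P m ij) (~~ disjoint_paths P).
Proof.
apply: (iffP forallPn) => [[i /forallPn[j]]|[m [[i j] /and4P[/= ij mi mj E]]]].
  rewrite negb_imply negbK => /andP[ij /hasP[v /mem_path_vertices[m mj vj]]].
  move=> /mem_path_vertices[m' mi vi]; exists m, (i, j).
  have mm' : m = m'.
    by move: vi; rewrite vj !path_endE /= !add0n !size_takel // => -[_ ->].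
  by apply/and4P; split; rewrite // mm' // -vi -mm' vj.
exists i; apply/forallPn; exists j; rewrite negb_imply ij negbK.
apply: (introT (@hasP _ _ (path_vertices (start j) (P j)))).
exists (path_end (start j) (take m (P j))).
  by apply/mem_path_vertices; exists m.
by apply/mem_path_vertices; exists m => //; rewrite (eqP E).
Qed.

(** The lowest height at which two paths meet, and a pair of paths meeting
    there; both depend only on the paths up to that height, so that exchanging
    the tails of the two paths does not change them. *)
Definition meet_height P : nat :=
  find (fun m => [exists ij, meet P m ij]) (iota 0 (max_height B).+1).

Definition meet_pair P : option ('I_k * 'I_k) :=
  [pick ij | meet P (meet_height P) ij].

Definition swap_tails P m i j : path_tuple B :=
  [ffun l => insub_bseq (max_height B)
     (take m (P l) ++ drop m (P (tperm i j l)))].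

Definition tail_swap (sP : 'S_k * path_tuple B) : 'S_k * path_tuple B :=
  if meet_pair sP.2 is Some ij then
    ((tperm ij.1 ij.2 * sP.1)%g, swap_tails sP.2 (meet_height sP.2) ij.1 ij.2)
  else sP.

Lemma meet_heightP P : ~~ disjoint_paths P ->
  exists2 ij, meet_pair P = Some ij & meet P (meet_height P) ij.
Proof.
move=> /not_disjointP[m [ij mP]].
have has_m : has (fun m => [exists ij, meet P m ij]) (iota 0 (max_height B).+1).
  apply/hasP; exists m; last by apply/existsP; exists ij.
  rewrite mem_iota /= add0n ltnS; case/and4P: mP => _ m1 _ _.
  exact: leq_trans m1 (size_bseq _).
have lt_find : (meet_height P < (max_height B).+1)%N.
  by move: has_m; rewrite has_find size_iota.
have /existsP[ij' ijP'] := nth_find 0%N has_m.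
rewrite nth_iota // add0n in ijP'.
rewrite /meet_pair; case: pickP => [ij'' H|/(_ ij')]; first by exists ij''.
by rewrite ijP'.
Qed.

Lemma meet_height_min P m ij : meet P m ij -> (meet_height P <= m)%N.
Proof.
move=> mP; rewrite leqNgt; apply/negP => lt.
have mH : (m < (max_height B).+1)%N.
  by rewrite ltnS; case/and4P: mP => _ m1 _ _; apply: leq_trans m1 (size_bseq _).
have := before_find 0%N lt; rewrite nth_iota // add0n => /existsP[].
by exists ij.
Qed.

Section Swap.
Variables (P : path_tuple B) (m : nat) (i j : 'I_k).
Hypothesis mP : meet P m (i, j).
Let P' := swap_tails P m i j.

Lemma swap_tailsE l :
  P' l = take m (P l) ++ drop m (P (tperm i j l)) :> seq bool.
Proof.
case/and4P: mP => /= _ mi mj _; rewrite ffunE val_insubd ifT //.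
apply: leq_trans (size_bseq (P (tperm i j l))); rewrite size_cat size_drop.
case: tpermP => [->|->|_ _].
- by rewrite size_takel // subnKC.
- by rewrite size_takel // subnKC.
by rewrite -size_drop -size_cat cat_take_drop.
Qed.

Lemma swap_tails_prefix l m' : (m' <= m)%N ->
  take m' (P' l) = take m' (P l) /\ (m' <= size (P' l))%N = (m' <= size (P l))%N.
Proof.
move=> m'm; case/and4P: mP => /= _ mi mj _.
have [|ml] := leqP m (size (P l)).
  move=> ml; rewrite swap_tailsE takel_cat ?size_takel // take_takel //.
  split=> //; rewrite size_cat size_takel //.
  by rewrite (leq_trans m'm) ?leq_addr // (leq_trans m'm).
have -> : P' l = P l :> seq bool; last by [].
rewrite swap_tailsE tpermD ?cat_take_drop //.
  by apply: contraTneq ml => <-; rewrite -leqNgt.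
by apply: contraTneq ml => <-; rewrite -leqNgt.
Qed.

Lemma swap_tails_meet m' ij : (m' <= m)%N -> meet P' m' ij = meet P m' ij.
Proof.
move=> m'm; rewrite /meet.
have [-> ->] := swap_tails_prefix ij.1 m'm.
by have [-> ->] := swap_tails_prefix ij.2 m'm.
Qed.

Lemma path_end_tperm l :
  path_end (start l) (take m (P l)) =
  path_end (start (tperm i j l)) (take m (P (tperm i j l))).
Proof. by case/and4P: mP => /= _ _ _ /eqP E; case: tpermP => [->|->|]. Qed.

Lemma swap_tails_end l :
  path_end (start l) (P' l) = path_end (start (tperm i j l)) (P (tperm i j l)).
Proof.
rewrite swap_tailsE -[in RHS](cat_take_drop m (P (tperm i j l))).
by rewrite !path_end_cat path_end_tperm.
Qed.

Lemma swap_tails_weight :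
  \prod_l path_weight x (start l) (P' l) = \prod_l path_weight x (start l) (P l).
Proof.
transitivity ((\prod_l path_weight x (start l) (take m (P l))) *
    \prod_l path_weight x (path_end (start l) (take m (P l))) (drop m (P l))).
  rewrite [X in _ * X](reindex_inj (@perm_inj _ (tperm i j))) -big_split /=.
  apply: eq_bigr => l _.
  by rewrite swap_tailsE path_weight_cat path_end_tperm.
rewrite -big_split /=; apply: eq_bigr => l _.
by rewrite -path_weight_cat cat_take_drop.
Qed.

Lemma swap_tailsK : swap_tails P' m i j = P.
Proof.
apply/ffunP=> l; apply/val_inj; rewrite ffunE val_insubd.
have -> : take m (P' l) ++ drop m (P' (tperm i j l)) = P l.
  have [-> _] := swap_tails_prefix l (leqnn m).
  rewrite -[RHS](cat_take_drop m); congr (_ ++ _).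
  rewrite swap_tailsE tpermK; case/and4P: mP => /= _ mi mj _.
  case: (tpermP i j l) => [->|->|_ _]; last by rewrite cat_take_drop.
    by rewrite drop_cat size_takel // ltnn subnn drop0.
  by rewrite drop_cat size_takel // ltnn subnn drop0.
by rewrite size_bseq.
Qed.

End Swap.

Definition ends_at (s : 'S_k) P : bool :=
  [forall i, path_end (start i) (P i) == B (s i)].

Definition crossing (sP : 'S_k * path_tuple B) : bool :=
  ends_at sP.1 sP.2 && ~~ disjoint_paths sP.2.

(** The exchange composes the permutation of the ends with a transposition and
    permutes the tails, which keeps the weight. *)
Lemma tail_swapP sP : crossing sP ->
  [/\ crossing (tail_swap sP), tail_swap (tail_swap sP) = sP,
    odd_perm (tail_swap sP).1 = ~~ odd_perm sP.1 &
    \prod_l path_weight x (start l) ((tail_swap sP).2 l) =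
    \prod_l path_weight x (start l) (sP.2 l)].
Proof.
case: sP => s P /andP[/forallP /= eP dP].
have [[i j] ijE ijP] := meet_heightP dP; set m := meet_height P in ijP.
have ij : i != j by case/and4P: ijP.
have swE : tail_swap (s, P) = ((tperm i j * s)%g, swap_tails P m i j).
  by rewrite /tail_swap /= ijE.
have mE : meet_height (swap_tails P m i j) = m.
  apply/anti_leq/andP; split.
    by apply: (@meet_height_min _ _ (i, j)); rewrite swap_tails_meet.
  rewrite leqNgt; apply/negP => lt.
  have /meet_heightP[ij' _] : ~~ disjoint_paths (swap_tails P m i j).
    by apply/not_disjointP; exists m, (i, j); rewrite swap_tails_meet.
  rewrite swap_tails_meet // 1?ltnW // => /meet_height_min.
  by rewrite leqNgt lt.
have pE : meet_pair (swap_tails P m i j) = Some (i, j).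
  rewrite /meet_pair mE -ijE; apply: eq_pick => ij'.
  by rewrite swap_tails_meet.
rewrite swE; split=> /=.
- apply/andP; split; last first.
    by apply/not_disjointP; exists m, (i, j); rewrite swap_tails_meet.
  by apply/forallP=> l; rewrite swap_tails_end //= permM eP.
- by rewrite /tail_swap /= pE /= mE swap_tailsK // mulgA tperm2 mul1g.
- by rewrite odd_mul_tperm ij.
exact: swap_tails_weight.
Qed.

(** Lindstroem--Gessel--Viennot: the path tuples with a common vertex cancel in
    pairs in the Leibniz expansion of the determinant. *)
Lemma lattice_sum_det :
  lattice_sum x a B = \det (\matrix_(i, j)
    \sum_(s : {bseq max_height B of bool} | path_end (start i) s == B j)
       path_weight x (start i) s).
Proof.
pose F (sP : 'S_k * path_tuple B) :=
  (-1) ^+ odd_perm sP.1 * \prod_l path_weight x (start l) (sP.2 l).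
have crossing0 : \sum_(sP | crossing sP) F sP = 0.
  rewrite (bigID (fun sP => odd_perm sP.1)) /=.
  rewrite (reindex_onto tail_swap tail_swap); last first.
    by move=> sP /andP[/tail_swapP[]].
  apply/eqP; rewrite addr_eq0 -sumrN; apply/eqP.
  apply: eq_big => sP; last first.
    move=> /andP[/andP[cr od] /eqP E].
    have [_ _ oE wE] := tail_swapP cr; rewrite E in oE wE; rewrite /F wE oE.
    by case: (odd_perm _); rewrite /= ?expr0 ?expr1 !(mul1r, mulN1r) ?opprK.
  apply/idP/idP => [/andP[/andP[cr od] /eqP E]|/andP[cr od]].
    by have [cr' _ oE _] := tail_swapP cr; rewrite E in cr' oE; rewrite cr' oE od.
  by have [cr' E oE _] := tail_swapP cr; rewrite cr' E oE od eqxx.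
rewrite /determinant; under eq_bigr => s _.
  under eq_bigr => i _ do rewrite mxE.
  rewrite bigA_distr_big_dep big_distrr /=.
  rewrite (eq_bigl (ends_at s)); last first.
    by move=> P; apply/familyP/forallP.
  over.
rewrite pair_big_dep /=.
rewrite (bigID (fun sP : 'S_k * path_tuple B => disjoint_paths sP.2)) /=.
rewrite [X in _ = _ + X]crossing0 addr0 /lattice_sum pair_big_dep /=.
exact: eq_bigl.
Qed.

End TailSwap.

Lemma lattice_sum_coef (R : comNzRingType) (x : nat -> R) k (al be h : 'I_k -> nat) :
  lattice_sum x (fun i => (al i)%:Z) (fun j => ((be j)%:Z, h j)) =
  \det (\matrix_(i, j) ('X^(be j) * lattice_poly x (h j))`_(al i)).
Proof.
rewrite lattice_sum_det; congr (\det _); apply/matrixP=> i j; rewrite !mxE.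
by apply: path_weight_sum; apply: (@leq_bigmax _ (fun j => h j)).
Qed.

(** * Determinants of polynomial columns *)

(** The coordinate of the wedge product of the polynomials [F c] at
    $t^0 \wedge t^1 \wedge \dots \wedge t^{n-1}$. *)
HB.lock Definition coef_det (R : comNzRingType) n (F : 'I_n -> {poly R}) : R :=
  \det (\matrix_(c, a) (F c)`_a).

Lemma coef_detE (R : comNzRingType) n (F : 'I_n -> {poly R}) :
  coef_det F = \det (\matrix_(c, a) (F c)`_a).
Proof. by rewrite unlock. Qed.

Section CoefDet.
Variables (R : comNzRingType) (n : nat).
Implicit Types F G H : 'I_n -> {poly R}.

Lemma eq_coef_det F G : F =1 G -> coef_det F = coef_det G.
Proof.
move=> FG; rewrite !coef_detE; congr (\det _).
by apply/matrixP=> c a; rewrite !mxE FG.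
Qed.

Lemma coef_det_linear F G H c0 (r : R) :
  F c0 = G c0 + r *: H c0 -> (forall c, c != c0 -> F c = G c) ->
  (forall c, c != c0 -> F c = H c) ->
  coef_det F = coef_det G + r * coef_det H.
Proof.
move=> E FG FH; rewrite !coef_detE -[\det _ in RHS]mul1r.
apply: (determinant_multilinear (i0 := c0)).
- by rewrite scale1r; apply/rowP=> a; rewrite !mxE E coefD coefZ.
- by apply/matrixP=> c a; rewrite !mxE FG // eq_sym neq_lift.
by apply/matrixP=> c a; rewrite !mxE FH // eq_sym neq_lift.
Qed.

Lemma coef_det_alternate F i j : i != j -> F i = F j -> coef_det F = 0.
Proof.
move=> ij E; rewrite coef_detE.
by apply: (determinant_alternate ij) => a; rewrite !mxE E.
Qed.

Lemma coef_det_add F G i j (r : R) : i != j ->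
  G j = F j + r *: F i -> (forall c, c != j -> G c = F c) ->
  coef_det G = coef_det F.
Proof.
move=> ij Gj GF; pose H c := if c == j then F i else F c.
have H0 : coef_det H = 0.
  by apply: (coef_det_alternate ij); rewrite /H eqxx (negPf ij).
rewrite (@coef_det_linear G F H j r) ?H0 ?mulr0 ?addr0 //.
  by rewrite /H eqxx.
by move=> c cj; rewrite /H (negPf cj) GF.
Qed.

Lemma coef_det_tperm F i j : i != j ->
  coef_det (F \o tperm i j) = - coef_det F.
Proof.
move=> ij; rewrite !coef_detE; set A := \matrix_(c, a) (F c)`_a.
have -> : \matrix_(c, a) ((F \o tperm i j) c)`_a = row_perm (tperm i j) A.
  by apply/matrixP=> c a; rewrite !mxE.
by rewrite row_permE det_mulmx det_perm odd_tperm ij expr1 mulN1r.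
Qed.

Lemma coef_det_map (S : comNzRingType) (f : {rmorphism R -> S}) F :
  coef_det (fun c => map_poly f (F c)) = f (coef_det F).
Proof.
rewrite !coef_detE -det_map_mx; congr (\det _); apply/matrixP=> c a.
by rewrite !mxE coef_map.
Qed.

End CoefDet.

Section LatticePoly.
Variables (R : comNzRingType) (x : nat -> R).

Lemma lattice_poly0 : lattice_poly x 0 = 1.
Proof. by rewrite lattice_polyE big_ord0. Qed.

Lemma lattice_polyS c : lattice_poly x c.+1 = lattice_poly x c * ('X + (x c)%:P).
Proof. by rewrite !lattice_polyE big_ord_recr. Qed.

Lemma size_lattice_poly c : size (lattice_poly x c) = c.+1.
Proof.
elim: c => [|c IH]; first by rewrite lattice_poly0 size_poly1.
rewrite lattice_polyS size_Mmonic ?monicXaddC // -?size_poly_eq0 ?IH //.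
by rewrite size_XaddC addn2.
Qed.

Lemma monic_lattice_poly c : lattice_poly x c \is monic.
Proof. by rewrite lattice_polyE; apply: monic_prod => i _; rewrite monicXaddC. Qed.

Lemma coef0_lattice_poly c : (lattice_poly x c)`_0 = \prod_(m < c) x m.
Proof.
elim: c => [|c IH]; first by rewrite lattice_poly0 coefC big_ord0.
by rewrite lattice_polyS mulrDr coefD coefMX coefMC IH add0r big_ord_recr.
Qed.

(** Multiplication by ['X] raises the height by one, modulo the previous
    heights. *)
Lemma lattice_polyXn c e : exists tau : nat -> R,
  'X^e * lattice_poly x c = \sum_(k < e.+1) tau k *: lattice_poly x (c + k).
Proof.
elim: e => [|e [tau IH]].
  by exists (fun=> 1); rewrite expr0 mul1r big_ord1 scale1r addn0.
exists (fun k => (if k is k'.+1 then tau k' else 0)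
  - (if (k <= e)%N then tau k * x (c + k)%N else 0)).
have Xl h : 'X * lattice_poly x h = lattice_poly x h.+1 - x h *: lattice_poly x h.
  by rewrite lattice_polyS mulrDr [_ * (x h)%:P]mulrC mul_polyC addrK mulrC.
rewrite exprS -mulrA IH mulr_sumr.
under eq_bigr do rewrite -scalerAr Xl scalerBr scalerA.
under [in RHS]eq_bigr do rewrite scalerBl.
rewrite !sumrB; congr (_ - _).
  rewrite [in RHS]big_ord_recl /= scale0r add0r.
  by apply: eq_bigr => k _; rewrite addnS.
rewrite [in RHS]big_ord_recr /= ltnn scale0r addr0.
by apply: eq_bigr => k _; rewrite -ltnS ltn_ord.
Qed.

End LatticePoly.

Lemma map_lattice_poly (R S : comNzRingType) (f : {rmorphism R -> S}) x c :
  map_poly f (lattice_poly x c) = lattice_poly (f \o x) c.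
Proof.
rewrite !lattice_polyE rmorph_prod; apply: eq_bigr => m _.
by rewrite rmorphD /= map_polyX map_polyC.
Qed.

Lemma eq_lattice_poly (R : comNzRingType) (x y : nat -> R) c :
  (forall m, (m < c)%N -> x m = y m) -> lattice_poly x c = lattice_poly y c.
Proof. by move=> xy; rewrite !lattice_polyE; apply: eq_bigr => m _; rewrite xy. Qed.

(** * Divided differences of such determinants *)

Section SchubertDet.
Variable n : nat.
Local Notation MP := {mpoly int[n]}.

Definition xvar (m : nat) : MP := if insub m is Some i then 'X_i else 0.

Lemma xvarE (i : 'I_n) : xvar i = 'X_i.
Proof. by rewrite /xvar valK. Qed.

Lemma msym_xvar (i j : 'I_n) (m : nat) : m != i :> nat -> m != j :> nat ->
  msym (tperm i j) (xvar m) = xvar m.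
Proof.
move=> mi mj; rewrite /xvar; case: insubP => [k _ km|_]; last exact: msym0.
by rewrite msymXi tpermD // -val_eqE /= km eq_sym.
Qed.

Local Notation P := (lattice_poly xvar).

Lemma msym_lattice_poly (i j : 'I_n) c : j = i.+1 :> nat -> c != j :> nat ->
  map_poly (msym (tperm i j)) (P c) = P c.
Proof.
move=> ji; have PS h : map_poly (msym (tperm i j)) (P h.+1) =
    map_poly (msym (tperm i j)) (P h) * ('X + (msym (tperm i j) (xvar h))%:P).
  by rewrite lattice_polyS rmorphM /= rmorphD /= map_polyX map_polyC.
elim/ltn_ind: c => -[|c] IH cj; first by rewrite !lattice_poly0 rmorph1.
have [cE|cE] := eqVneq c j; last first.
  rewrite PS IH // msym_xvar ?lattice_polyS //.
  by apply: contraNneq cj => ->; rewrite ji.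
rewrite cE ji !PS IH; [|lia|lia].
rewrite !lattice_polyS -ji !xvarE !msymXi tpermL tpermR.
exact: mulrAC.
Qed.

Lemma ddiffMr (i j : 'I_n) (f g : MP) : i != j ->
  msym (tperm i j) g = g -> ddiff i j (f * g) = ddiff i j f * g.
Proof.
move=> ij gs; apply: (mulf_mpolyX_sub ij).
by rewrite mulrAC !ddiffP msymM gs mulrBl.
Qed.

Lemma msym_ddiff (i j : 'I_n) (f : MP) : i != j ->
  msym (tperm i j) (ddiff i j f) = ddiff i j f.
Proof.
move=> ij; apply: (mulf_mpolyX_sub ij).
have := congr1 (msym (tperm i j)) (ddiffP i j f).
rewrite msymM !msymB !msymXi -msymMm tpermL tpermR tperm2 msym1m ddiffP => H.
by rewrite -[RHS]opprB -H; ring.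
Qed.

(** Only the column of height [j] depends on [x_i] and [x_j] asymmetrically,
    and the divided difference lowers that height by one. *)
Lemma ddiff_coef_det (i j : 'I_n) (b h : 'I_n -> nat) (c0 : 'I_n) :
  j = i.+1 :> nat -> h c0 = j -> (forall c, c != c0 -> h c != j) ->
  ddiff i j (coef_det (fun c => 'X^(b c) * P (h c))) =
  coef_det (fun c => 'X^(b c) * P (if c == c0 then i : nat else h c)).
Proof.
move=> ji hc0 hc; have ij : i != j by rewrite -val_eqE /= ji; lia.
apply: (mulf_mpolyX_sub ij); rewrite ddiffP; apply/eqP; rewrite subr_eq; apply/eqP.
rewrite mulrC addrC -coef_det_map; apply: (coef_det_linear (c0 := c0)).
- have Pi : map_poly (msym (tperm i j)) (P i) = P i.
    by apply: msym_lattice_poly => //; rewrite ji; lia.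
  rewrite eqxx rmorphM /= map_polyXn hc0 ji lattice_polyS rmorphM /= Pi.
  rewrite rmorphD /= map_polyX map_polyC /= xvarE msymXi tpermL.
  by rewrite -mul_polyC rmorphB /=; ring.
- by move=> c cc0; rewrite rmorphM /= map_polyXn msym_lattice_poly // hc.
by move=> c cc0; rewrite (negPf cc0).
Qed.

Definition schubert_det (b : 'I_n -> nat) : MP :=
  coef_det (fun c => 'X^(b c) * P c).

(** Signs are not tracked: exchanging two starting points of a path
    representation changes the sign. *)
Definition represented (u : 'S_n) (b : 'I_n -> nat) : Prop :=
  exists e : bool, schubert u = (-1) ^+ e * schubert_det b.

Lemma ddiff_sign (i j : 'I_n) (e : bool) (f : MP) : i != j ->
  ddiff i j ((-1) ^+ e * f) = (-1) ^+ e * ddiff i j f.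
Proof. by move=> ij; rewrite mulrC ddiffMr 1?mulrC // rmorph_sign. Qed.

Lemma schubert_desc (u : 'S_n) (i j : 'I_n) : j = i.+1 :> nat -> (u j < u i)%N ->
  schubert (comp_perm u (tperm i j)) = ddiff i j (schubert u).
Proof. by move=> ji uji; rewrite schubert_ddiff // ell_descent. Qed.

(** The basic move: the two columns involved span [x^beta P_i] and
    [x^beta.+1 P_i] both before and after the divided difference. *)
Lemma represented_desc (u : 'S_n) (i j : 'I_n) (b b' : 'I_n -> nat) beta :
  j = i.+1 :> nat -> (u j < u i)%N -> represented u b ->
  b' i = beta -> b' j = beta ->
  (b i, b j) = (beta, beta.+1) \/ (b i, b j) = (beta.+1, beta) ->
  (forall c, c != i -> c != j -> b' c = b c) ->
  represented (comp_perm u (tperm i j)) b'.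
Proof.
move=> ji uji [e ue] b'i b'j bij b'b.
have ij : i != j by rewrite -val_eqE /= ji; lia.
pose G c := 'X^(if c == j then beta.+1 else b' c) * P (if c == j then i : nat else c).
have detG : schubert_det b' = coef_det G.
  apply: (@coef_det_add _ _ _ _ i j (xvar i)) => //.
    rewrite /G eqxx (negPf ij) b'i b'j ji lattice_polyS -mul_polyC exprS; ring.
  by move=> c cj; rewrite /G (negPf cj).
rewrite /represented schubert_desc // ue ddiff_sign // detG.
rewrite /schubert_det (@ddiff_coef_det i j b (fun c => c) j) //.
case: bij => -[bi bj].
  exists e; rewrite (@eq_coef_det _ _ _ G) // => c; rewrite /G.
  have [->|cj] := eqVneq c j; first by rewrite bj.
  by have [->|ci] := eqVneq c i; rewrite ?bi ?b'i // b'b.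
exists (~~ e); rewrite signrN mulNr -mulrN -(coef_det_tperm _ ij).
rewrite (@eq_coef_det _ _ _ (G \o tperm i j)) // => c; rewrite /G /=.
case: tpermP => [->|->|/eqP ci /eqP cj].
- by rewrite eqxx (negPf ij) bi.
- by rewrite eqxx (negPf ij) bj b'i.
by rewrite (negPf cj) b'b.
Qed.

End SchubertDet.

(** * Descending from the longest permutation *)

Lemma adjacent_chain n (r : rel 'I_n) lo hi : transitive r ->
  (forall i j : 'I_n, j = i.+1 :> nat -> (lo <= i)%N -> (j <= hi)%N -> r i j) ->
  forall i j : 'I_n, (i < j)%N -> (lo <= i)%N -> (j <= hi)%N -> r i j.
Proof.
move=> rT radj i j; have [d] := ubnP (j - i); elim: d => // d IH in i *.
move=> dij ij loi jhi; have i1 : (i.+1 < n)%N by have := ltn_ord j; lia.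
have rii : r i (Ordinal i1) by apply: radj => //=; lia.
have [->//|ne] := eqVneq j (Ordinal i1).
by apply: rT rii (IH _ _ _ _ _) => //=; move: ne; rewrite -val_eqE /=; lia.
Qed.

Definition ascent n (u : 'S_n) (ij : 'I_n * 'I_n) : bool :=
  (ij.2 == ij.1.+1 :> nat) && (u ij.1 < u ij.2)%N.

Lemma no_ascent_dec n (u : 'S_n) lo hi :
  (forall i j : 'I_n, (lo <= i)%N -> (j <= hi)%N -> ~~ ascent u (i, j)) ->
  forall i j : 'I_n, (i < j)%N -> (lo <= i)%N -> (j <= hi)%N -> (u j < u i)%N.
Proof.
move=> noasc; apply: (@adjacent_chain _ (fun i j => u j < u i)%N).
  by move=> y x z yx zy; apply: ltn_trans zy yx.
move=> i j ji loi jhi; have := noasc i j loi jhi; rewrite /ascent /= ji eqxx /=.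
by rewrite (perm_lt_neq u) ?negbK // -val_eqE /=; lia.
Qed.

Lemma ascent_exists n (u : 'S_n) : u != w0 n -> exists ij, ascent u ij.
Proof.
move=> uw0; case: (pickP (ascent u)) => [ij|noasc]; first by exists ij.
case/eqP: uw0; apply: perm_lt_inj => i j ij.
have := @no_ascent_dec n u 0 n; move=> /(_ _ i j ij (leq0n i) (ltnW (ltn_ord j))) H.
rewrite !permE /= [RHS]ltnNge leq_sub2l /=; last by lia.
by apply/negbTE; rewrite -leqNgt ltnW // H // => *; rewrite noasc.
Qed.

Lemma first_ascent n (u : 'S_n) : u != w0 n -> exists2 ij, ascent u ij &
  forall k : 'I_n, (k < ij.1)%N -> (u ij.1 < u k)%N.
Proof.
move=> /ascent_exists[ij0 asc0].
have [[i j] /= asc min_i] := arg_minnP (fun ij : 'I_n * 'I_n => val ij.1) asc0.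
exists (i, j) => //= k ki; apply: (@no_ascent_dec n u 0 i) => // k' l' _ l'i.
apply/negP=> asc'; have := min_i _ asc'; case/andP: asc' => /= /eqP; lia.
Qed.

Lemma last_ascent n (u : 'S_n) : u != w0 n -> exists2 ij, ascent u ij &
  forall k : 'I_n, (ij.2 < k)%N -> (u k < u ij.2)%N.
Proof.
move=> /ascent_exists[ij0 asc0].
have [[i j] /= asc max_i] := arg_maxnP (fun ij : 'I_n * 'I_n => val ij.1) asc0.
exists (i, j) => //= k jk; case/andP: asc => /= /eqP ji _.
apply: (@no_ascent_dec n u j n) => //; last exact/ltnW/ltn_ord.
move=> k' l' jk' _; apply/negP=> asc'; have := max_i _ asc'; rewrite /=; lia.
Qed.

Lemma card_gt_ord n (i : 'I_n) : #|[pred j : 'I_n | (i < j)%N]| = (n.-1 - i)%N.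
Proof.
have := cardC [pred j : 'I_n | (j < i.+1)%N]; rewrite card_ord.
have -> : #|[pred j : 'I_n | (j < i.+1)%N]| = i.+1.
  by rewrite -sum1_card -(big_ord_widen n (fun=> 1%N)) ?ltn_ord // sum1_card card_ord.
have -> : #|[predC [pred j : 'I_n | (j < i.+1)%N]]| = #|[pred j : 'I_n | (i < j)%N]|.
  by apply: eq_card => j; rewrite !inE -leqNgt.
by lia.
Qed.

(** Ordered by their exponents, the columns are triangular, with diagonal entries
    $x_1 \cdots x_c$. *)
Lemma schubert_det_w0 n (b : 'I_n -> nat) :
  injective b -> (forall c, b c < n)%N -> represented (w0 n) b.
Proof.
move=> b_inj b_lt; pose f c := Ordinal (b_lt c).
have f_inj : injective f by move=> c d /(congr1 val)/b_inj.
pose p := perm f_inj; exists (odd_perm p).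
rewrite /schubert_det coef_detE; set A := \matrix_(c, a) _.
have pA : perm_mx p *m (row_perm (p^-1)%g A) = A.
  by rewrite row_permE mulmxA -perm_mxM mulgV perm_mx1 mul1mx.
rewrite -pA det_mulmx det_perm mulrA -expr2 sqrr_sign mul1r.
rewrite -det_tr det_trig; last first.
  apply/is_trig_mxP=> k l kl; rewrite !mxE coefXnM.
  have -> : b ((p^-1)%g l) = l.
    by have /(congr1 val) := permKV p l; rewrite permE.
  by rewrite kl.
rewrite (reindex_inj (@perm_inj _ p)) schubert_w0 /=.
under [in RHS]eq_bigr => c _.
  rewrite !mxE permK coefXnM permE /= ltnn subnn coef0_lattice_poly.
  rewrite (big_ord_widen n (fun m => xvar n m)); last exact/ltnW/ltn_ord.
  over.
rewrite (exchange_big_dep predT) //=; apply: eq_bigr => m _.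
rewrite (eq_bigr (fun=> 'X_m)) => [|c _]; last exact: xvarE.
rewrite prodr_const; congr (_ ^+ _).
by rewrite -card_gt_ord; apply: eq_card => c; rewrite !inE.
Qed.

Lemma ell_desc_ind n (Q : 'S_n -> Prop) :
  (forall u, (forall u', (ell u < ell u')%N -> Q u') -> Q u) -> forall u, Q u.
Proof.
move=> IH u; have [m] := ubnP (n * n - ell u); elim: m => // m IHm in u *.
move=> um; apply: IH => u' uu'; apply: IHm.
by have := ell_le u'; lia.
Qed.

(** If every member of [Q] other than [w0] comes from a longer one by a basic move
    compatible with the statistic [b], then [b] represents all of [Q]. *)
Lemma represented_top_down n (Q : 'S_n -> Prop) (b : 'S_n -> 'I_n -> nat) :
  (Q (w0 n) -> injective (b (w0 n))) -> (forall u c, b u c < n)%N ->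
  (forall u, Q u -> u != w0 n -> exists i j : 'I_n, exists beta,
    [/\ j = i.+1 :> nat, (u i < u j)%N, Q (comp_perm u (tperm i j)),
      b u i = beta /\ b u j = beta &
      let b' := b (comp_perm u (tperm i j)) in
      ((b' i, b' j) = (beta, beta.+1) \/ (b' i, b' j) = (beta.+1, beta)) /\
      forall c, c != i -> c != j -> b u c = b' c]) ->
  forall u, Q u -> represented u (b u).
Proof.
move=> b_inj b_lt step; apply: ell_desc_ind => u IH Qu.
have [uw0|uw0] := eqVneq u (w0 n).
  by rewrite uw0 in Qu *; apply: schubert_det_w0; [apply: b_inj | apply: b_lt].
have [i [j [beta [ji uij Qu' [bi bj] [bb' b'b]]]]] := step u Qu uw0.
rewrite -(comp_perm_tpermK u i j); apply: represented_desc bb' _ => //.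
- by rewrite !comp_permE tpermL tpermR.
- by apply: IH => //; apply: ell_ascent.
- by rewrite comp_perm_tpermK.
- by rewrite comp_perm_tpermK.
by rewrite comp_perm_tpermK.
Qed.

Section AdjacentSwap.
Variables (n : nat) (i j : 'I_n).
Hypothesis ji : j = i.+1 :> nat.
Let s := tperm i j.

Lemma tperm_adjacent_lt (k l : 'I_n) :
  (k < l)%N -> (k, l) != (i, j) -> (s k < s l)%N.
Proof.
rewrite xpair_eqE -!val_eqE /= /s => kl ne.
by case: tpermP => [E|E|/eqP + /eqP +]; case: tpermP => [F|F|/eqP + /eqP +];
  rewrite -?val_eqE /=; subst => //=; lia.
Qed.

Lemma tperm_adjacent_ltl (k c : 'I_n) : c != i -> c != j ->
  (s k < c)%N = (k < c)%N.
Proof. by rewrite -!val_eqE /= /s; case: tpermP => [->|->|]; lia. Qed.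

Lemma tperm_adjacent_gtl (k c : 'I_n) : c != i -> c != j ->
  (c < s k)%N = (c < k)%N.
Proof. by rewrite -!val_eqE /= /s; case: tpermP => [->|->|]; lia. Qed.

Lemma card_tperm (p : pred 'I_n) : #|[set k | p (s k)]| = #|[set k | p k]|.
Proof.
rewrite -[RHS](card_preimset _ (@perm_inj _ s)).
by apply: eq_card => k; rewrite !inE.
Qed.

End AdjacentSwap.

(** * Permutations avoiding 213 *)

Definition larger_before n (u : 'S_n) (c : 'I_n) : nat :=
  #|[set k : 'I_n | (k < c)%N && (u c < u k)%N]|.

Definition no213 n (u : 'S_n) : Prop :=
  forall a b c : 'I_n, (a < b)%N -> (b < c)%N -> (u b < u a)%N -> (u a < u c)%N ->
  False.

Lemma card_lt_ord n (A : {set 'I_n}) (c : 'I_n) : c \notin A -> (#|A| < n)%N.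
Proof.
move=> cA; rewrite -[X in (_ < X)%N](card_ord n) -cardsT; apply/proper_card/properP.
by split=> //; exists c.
Qed.

(** The move is at the last ascent [i, j]: no earlier entry has its value between
    [u i] and [u j], it would be the 2 of a 213, so the statistic agrees at [i] and
    [j]; and as nothing after [j] exceeds [u j], exchanging the two entries creates
    no 213. *)
Lemma represented_no213 n (u : 'S_n) : no213 u -> represented u (larger_before u).
Proof.
move: u; apply: represented_top_down => [_|u c|u Qu uw0].
- have E (c : 'I_n) : larger_before (w0 n) c = c.
    rewrite /larger_before (_ : [set _ | _] = [set k : 'I_n | (k < c)%N]).
      rewrite -sum1_card (eq_bigl (fun k : 'I_n => k < c)%N) => [|k];
        last by rewrite inE.
      by rewrite -(big_ord_widen n (fun=> 1%N)) ?sum1_card ?card_ord // ltnW.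
    apply/setP=> k; rewrite !inE !permE /=.
    by have := ltn_ord c; have := ltn_ord k; lia.
  by move=> c d; rewrite !E; apply: ord_inj.
- by apply: (card_lt_ord (c := c)); rewrite inE ltnn.
have [[i j] /andP[/= /eqP ji uij] last_ij] := last_ascent uw0.
set s := tperm i j; have ij : i != j by rewrite -val_eqE /= ji; lia.
have nji : (j == i) = false by rewrite eq_sym (negPf ij).
exists i, j, (larger_before u j).
have bij : larger_before u i = larger_before u j.
  apply: eq_card => k; rewrite !inE; apply/andP/andP=> -[ki uk]; last first.
    by split; last lia; cmp_pos k i => //; lia.
  split; first by lia.
  cmp_val u k j; last by [].
  by case: (Qu k i j); rewrite ?ji.
split=> //.
- move=> a b c ab bc; rewrite !comp_permE -/s => ba ac.
  have abij : (a, b) != (i, j).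
    apply/eqP=> -[ai bj]; subst a b; move: ac; rewrite /s tpermL tpermD.
    + by have := last_ij c bc; lia.
    + by rewrite -val_eqE /=; lia.
    by rewrite -val_eqE /=; lia.
  have bcij : (b, c) != (i, j).
    by apply/eqP=> -[bi cj]; subst b c; move: ba ac; rewrite /s tpermL tpermR; lia.
  apply: (Qu (s a) (s b) (s c)) => //; exact: tperm_adjacent_lt.
split; last first.
  move=> c ci cj; rewrite /larger_before !comp_permE tpermD 1?eq_sym //.
  rewrite -(card_tperm i j (fun k => (k < c)%N && (u c < u k)%N)).
  by apply: eq_card => k; rewrite !inE comp_permE (tperm_adjacent_ltl ji).
have fixk (k : 'I_n) : (k < i)%N -> s k = k.
  by move=> ki; rewrite /s tpermD // -val_eqE /=; lia.
left; congr (_, _).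
  apply: eq_card => k; rewrite !inE !comp_permE tpermL -/s.
  by cmp_pos k i; [rewrite (fixk k) // |]; lia.
rewrite -bij /larger_before (cardsD1 i) inE !comp_permE tpermL tpermR.
rewrite ji ltnSn uij add1n; congr _.+1; apply: eq_card => k.
rewrite !inE !comp_permE -/s -val_eqE /=.
by cmp_pos k i; [rewrite (fixk k) // |]; lia.
Qed.

(** * Permutations avoiding 132, relative to a partition into blocks *)

Definition blocks_inverted n (blk : 'I_n -> nat) (u : 'S_n) : Prop :=
  forall a b : 'I_n, (a < b)%N -> blk a != blk b -> (u b < u a)%N.

Definition no132 n (u : 'S_n) : Prop :=
  forall a b c : 'I_n, (a < b)%N -> (b < c)%N -> (u a < u c)%N -> (u c < u b)%N ->
  False.

(** The Lehmer code inside each block, shifted by the number of positions before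
    the block. The shift could be any one that makes the statistic bijective at
    [w0]; this one agrees with [larger_before] on permutations that are increasing
    in each block. *)
Definition block_code n (blk : 'I_n -> nat) (u : 'S_n) (c : 'I_n) : nat :=
  #|[set k : 'I_n | if blk k == blk c then (c < k)%N && (u k < u c)%N
                    else (k < c)%N]|.

(** As for 213, with the first ascent and the entries after it. The blocks do not
    interfere, since ascents only occur inside them. *)
Lemma represented_no132 n (blk : 'I_n -> nat) (u : 'S_n) :
  (forall a b : 'I_n, (a < b)%N -> (blk a <= blk b)%N) ->
  blocks_inverted blk u -> no132 u -> represented u (block_code blk u).
Proof.
move=> blk_mono inv_u n132; move: {inv_u n132}(conj inv_u n132); move: u.
apply: represented_top_down => [_|u c|u [inv_u Qu] uw0].
- have w0E (k c : 'I_n) : (c < k)%N && (w0 n k < w0 n c)%N = (c < k)%N.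
    by rewrite !permE /=; have := ltn_ord k; lia.
  have lt (c d : 'I_n) : (c < d)%N ->
      block_code blk (w0 n) c != block_code blk (w0 n) d.
    move=> cd; rewrite neq_ltn; apply/orP; have cd' := blk_mono _ _ cd.
    have [E|E] := eqVneq (blk c) (blk d); [right | left];
      apply/proper_card/properP; split.
    + apply/subsetP=> k; rewrite !inE !w0E E.
      case: ifP => [_|/negP kd kd']; first by lia.
      cmp_pos k c; first by [].
      by have := blk_mono _ _ kd'; have := blk_mono c k; lia.
    + by exists d; rewrite !inE !w0E ?E ?eqxx // ltnn.
    + apply/subsetP=> k; rewrite !inE !w0E; case: eqP => [kc ck|kc kc'].
        rewrite kc (negPf E); have := blk_mono d k; cmp_pos k d; first by [].
        by lia.
      by have := blk_mono _ _ kc'; case: ifP; lia.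
    by exists c; rewrite !inE !w0E ?(negPf E) ?eqxx // ltnn.
  move=> c d /eqP cd; apply: ord_inj; case: (ltngtP c d) => // /lt; last first.
    by rewrite eq_sym cd.
  by rewrite cd.
- by apply: (card_lt_ord (c := c)); rewrite inE eqxx ltnn.
have [[i j] /andP[/= /eqP ji uij] first_ij] := first_ascent uw0.
set s := tperm i j; have ij : i != j by rewrite -val_eqE /= ji; lia.
have blkij : blk i = blk j.
  by apply/eqP; apply: contraT => /(inv_u i j); rewrite ji; lia.
have blks k : blk (s k) = blk k by rewrite /s; case: tpermP => [->|->|].
exists i, j, (block_code blk u i).
have bij : block_code blk u j = block_code blk u i.
  apply: eq_card => k; rewrite !inE blkij; case: eqP => // kj; last first.
    by cmp_pos k i; lia.
  apply/andP/andP=> -[ki uk]; last first.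
    by split; last lia; cmp_pos k j => //; lia.
  split; first by lia.
  cmp_val u i k; last by [].
  by case: (Qu i j k); rewrite ?ji //; lia.
split=> //.
- split=> [a b ab blkab|a b c ab bc].
    rewrite !comp_permE; apply: inv_u; last by rewrite !blks.
    apply: (tperm_adjacent_lt ji ab); apply: contraNneq blkab => -[-> ->].
    by rewrite blkij.
  rewrite !comp_permE -/s => ac cb.
  have bcij : (b, c) != (i, j).
    apply/eqP=> -[bi cj]; subst b c; move: ac; rewrite /s tpermR tpermD.
    + by have := first_ij a ab; lia.
    + by rewrite -val_eqE /=; lia.
    by rewrite -val_eqE /=; lia.
  have abij : (a, b) != (i, j).
    by apply/eqP=> -[ai bj]; subst a b; move: ac cb; rewrite /s tpermL tpermR; lia.
  apply: (Qu (s a) (s b) (s c)) => //; exact: tperm_adjacent_lt.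
split; last first.
  move=> c ci cj; rewrite /block_code !comp_permE tpermD 1?eq_sym //.
  rewrite -(card_tperm i j (fun k => if blk k == blk c then
    (c < k)%N && (u k < u c)%N else (k < c)%N)).
  apply: eq_card => k; rewrite !inE comp_permE -/s blks.
  by rewrite (tperm_adjacent_ltl ji) // (tperm_adjacent_gtl ji).
have fixk (k : 'I_n) : (j < k)%N -> s k = k.
  by move=> ki; rewrite /s tpermD // -val_eqE /=; lia.
right; congr (_, _).
  rewrite -bij /block_code (cardsD1 j) inE !comp_permE tpermL tpermR blkij eqxx.
  rewrite ji ltnSn uij add1n; congr _.+1; apply: eq_card => k.
  rewrite !inE !comp_permE -/s -val_eqE /=.
  have [kj|/eqP kj] := eqVneq (blk k) (blk j); last by cmp_pos k i; lia.
  by cmp_pos k j; [|rewrite (fixk k) //]; lia.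
apply: eq_card => k; rewrite !inE !comp_permE tpermR -/s blkij.
have [kj|/eqP kj] := eqVneq (blk k) (blk j); last by cmp_pos k i; lia.
by cmp_pos k j; [|rewrite (fixk k) //]; lia.
Qed.

(** * Exponents of Schubert polynomials *)

Section DdiffSupport.
Variables (n : nat) (i j : 'I_n).
Hypothesis ij : i != j.
Local Notation MP := {mpoly int[n]}.
Implicit Types (f g : MP) (m : 'X_{1..n}).

Lemma ddiffD f g : ddiff i j (f + g) = ddiff i j f + ddiff i j g.
Proof.
by apply: (mulf_mpolyX_sub ij); rewrite mulrDl !ddiffP msymD opprD addrACA.
Qed.

Lemma ddiffZ (c : int) f : ddiff i j (c *: f) = c *: ddiff i j f.
Proof.
by apply: (mulf_mpolyX_sub ij); rewrite -scalerAl !ddiffP msymZ scalerBr.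
Qed.

Lemma ddiff0 : ddiff i j (0 : MP) = 0.
Proof. by apply: (mulf_mpolyX_sub ij); rewrite ddiffP msym0 mul0r subrr. Qed.

Definition mnm_set m p q : 'X_{1..n} :=
  [multinom (if l == i then p else if l == j then q else m l) | l < n].

Lemma mnm_setE m p q l :
  mnm_set m p q l = if l == i then p else if l == j then q else m l.
Proof. by rewrite mnmE. Qed.

Lemma mpolyX_setSl m p q : 'X_[mnm_set m p q] * 'X_i = 'X_[mnm_set m p.+1 q] :> MP.
Proof.
rewrite -mpolyXD; congr 'X_[_]; apply/mnmP=> l; rewrite mnmDE mnm1E !mnm_setE.
by rewrite eq_sym; case: eqP => _; rewrite ?addn0 ?addn1.
Qed.

Lemma mpolyX_setSr m p q : 'X_[mnm_set m p q] * 'X_j = 'X_[mnm_set m p q.+1] :> MP.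
Proof.
rewrite -mpolyXD; congr 'X_[_]; apply/mnmP=> l; rewrite mnmDE mnm1E !mnm_setE.
have [->|li] := eqVneq l i; first by rewrite eq_sym (negPf ij) addn0.
by rewrite eq_sym; case: eqP => _; rewrite ?addn0 ?addn1.
Qed.

Lemma mdeg_set m p q : (mdeg (mnm_set m p q) + m i + m j = mdeg m + p + q)%N.
Proof.
have E p' q' : mdeg (mnm_set m p' q') = (mdeg (mnm_set m 0 0) + p' + q')%N.
  have -> : mnm_set m p' q' = (mnm_set m 0 0 + U_(i) *+ p' + U_(j) *+ q')%MM.
    apply/mnmP=> l; rewrite !mnmDE !mulmnE !mnm1E !mnm_setE ![_ == l]eq_sym.
    have [->|li] := eqVneq l i; first by rewrite (negPf ij); lia.
    by case: eqP => _; lia.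
  by rewrite !mdegD !mdegMn !mdeg1 !mul1n.
have mE : mnm_set m (m i) (m j) = m.
  by apply/mnmP=> l; rewrite mnm_setE; case: eqP => [->//|_]; case: eqP => [->|].
by have := E (m i) (m j); have := E p q; rewrite mE; lia.
Qed.

Lemma ddiff_mpolyX m : (m j <= m i)%N ->
  ddiff i j ('X_[m] : MP) =
  \sum_(k < m i - m j) 'X_[mnm_set m (m i - k.+1) (m j + k)].
Proof.
move=> mji; apply: (mulf_mpolyX_sub ij); rewrite ddiffP mulr_suml.
pose T k : MP := 'X_[mnm_set m (m i - k) (m j + k)].
rewrite (eq_bigr (fun k : 'I__ => T k - T k.+1)) => [|k _]; last first.
  rewrite mulrBr mpolyX_setSl mpolyX_setSr /T addnS.
  by rewrite (_ : (m i - k.+1).+1 = m i - k)%N //; have := ltn_ord k; lia.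
rewrite -(big_mkord xpredT (fun k => T k - T k.+1)).
rewrite (@telescope_sumr_eq _ 0 _ (fun k => - T k)) ?leq0n //; last first.
  by move=> k _; rewrite opprK addrC.
rewrite opprK addrC.
rewrite /T subn0 addn0 subKn // subnKC // msymX.
have -> : [multinom m ((tperm i j)^-1 k)%g | k < n] = mnm_set m (m j) (m i).
  apply/mnmP=> l; rewrite mnmE tpermV mnm_setE.
  case: tpermP => [->|->|/eqP/negPf-> /eqP/negPf->//]; rewrite ?eqxx //.
  by rewrite eq_sym (negPf ij).
suff -> : mnm_set m (m i) (m j) = m by [].
by apply/mnmP=> l; rewrite mnm_setE; case: eqP => [->//|_]; case: eqP => [->|].
Qed.

End DdiffSupport.

(** $\partial_i (x_i^p x_{i+1}^q)$ is a signed sum of monomials of degree $p+q-1$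
    with both exponents below $\max(p, q)$. *)
Lemma msupp_ddiff n (i j : 'I_n) (f : {mpoly int[n]}) m : i != j ->
  m \in msupp (ddiff i j f) -> exists2 m', m' \in msupp f &
  [/\ mdeg m' = (mdeg m).+1, forall k, k != i -> k != j -> m k = m' k,
    (m i < maxn (m' i) (m' j))%N & (m j < maxn (m' i) (m' j))%N].
Proof.
move=> ij.
have mono (a b : 'I_n) (m' m1 : 'X_{1..n}) : a != b -> (m' b <= m' a)%N ->
    m1 \in msupp (ddiff a b ('X_[m'] : {mpoly int[n]})) ->
  [/\ mdeg m' = (mdeg m1).+1, forall k, k != a -> k != b -> m1 k = m' k,
    (m1 a < maxn (m' a) (m' b))%N & (m1 b < maxn (m' a) (m' b))%N].
  move=> ab ba; rewrite ddiff_mpolyX // => /msupp_sum_le/flattenP[s /mapP[k _ ->]].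
  rewrite msuppX inE => /eqP->; have := ltn_ord k => km.
  have := mdeg_set ab m' (m' a - k.+1) (m' b + k); rewrite !mnm_setE eqxx.
  rewrite eq_sym (negPf ab) eqxx => md; split; try lia.
  by move=> l la lb; rewrite mnm_setE (negPf la) (negPf lb).
rewrite {1}[f]mpolyE (big_morph _ (ddiffD ij) (ddiff0 ij)).
move=> /msupp_sum_le/flattenP[s /mapP[m' m'f ->]].
rewrite ddiffZ // => /msuppZ_le mm'; rewrite mem_filter /= in m'f; exists m' => //.
case/orP: (leq_total (m' j) (m' i)) => ji; first exact: (mono i j).
have ji' : j != i by rewrite eq_sym.
move: mm'; rewrite ddiffC // (perm_mem (msuppN _)) => /(mono _ _ _ _ ji' ji).
by case=> *; split=> //; rewrite ?[maxn (m' i) _]maxnC // => k ki kj; auto.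
Qed.

Lemma ell_adjacent n (u : 'S_n) (i j : 'I_n) : j = i.+1 :> nat -> (u i < u j)%N ->
  ell (comp_perm u (tperm i j)) = (ell u).+1.
Proof.
move=> ji uij; have := ell_comp_perm u (tperm i j).
have inv1 : inversions (tperm i j) = [set (i, j)].
  apply/setP=> -[a b]; rewrite !inE /=; apply/andP/eqP => [[ab]|[-> ->]].
    apply: contraTeq => ne; rewrite -leqNgt ltnW //; exact: tperm_adjacent_lt.
  by rewrite tpermL tpermR ji.
rewrite [ell (tperm i j)]/ell inv1 (setIidPl _) ?cards1; first by lia.
by rewrite sub1set !inE /= !comp_permE tpermL tpermR ji ltnSn.
Qed.

Lemma ell_w0 n : ell (w0 n) = (\sum_(i < n) (n.-1 - i))%N.
Proof.
rewrite /ell -sum1_card (eq_bigl (fun p : 'I_n * 'I_n => predT p.1 && (p.1 < p.2)%N)).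
  rewrite -(pair_big_dep predT (fun i j : 'I_n => i < j)%N (fun _ _ => 1%N)) /=.
  apply: eq_bigr => i _; rewrite sum1_card -card_gt_ord.
  by apply: eq_card => j; rewrite !inE.
move=> -[i j]; rewrite !inE !permE /=; have := ltn_ord i; have := ltn_ord j; lia.
Qed.

(** The bounds at adjacent variables differ by one, which is what a divided
    difference takes from the larger of the two exponents. *)
Lemma msupp_schubert n (u : 'S_n) m : m \in msupp (schubert u) ->
  mdeg m = ell u /\ forall l, (m l <= n.-1 - l)%N.
Proof.
move: u m; apply: ell_desc_ind => u IH m.
have [->|/ascent_exists[[i j] /andP[/= /eqP ji uij]]] := eqVneq u (w0 n).
  have -> : schubert (w0 n) = 'X_[[multinom (n.-1 - i)%N | i < n]].
    by rewrite schubert_w0 mpolyXE_id; apply: eq_bigr => i _; rewrite mnmE.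
  rewrite msuppX inE => /eqP->; split; last by move=> l; rewrite mnmE.
  by rewrite mdegE ell_w0; apply: eq_bigr => i _; rewrite mnmE.
have ij : i != j by rewrite -val_eqE /= ji; lia.
have lt := ell_ascent ji uij.
rewrite -[u](comp_perm_tpermK u i j) schubert_desc //; last first.
  by rewrite !comp_permE tpermL tpermR.
move=> /(msupp_ddiff ij)[m' /(IH _ lt)[dm' bm'] [dm bm bi bj]].
rewrite comp_perm_tpermK; split; first by have := ell_adjacent ji uij; lia.
move=> l; have := bm' i; have := bm' j.
have [->|li] := eqVneq l i; first by lia.
have [->|lj] := eqVneq l j; first by lia.
by rewrite bm.
Qed.

Lemma msym_schubert n (u : 'S_n) (i j : 'I_n) : j = i.+1 :> nat -> (u i < u j)%N ->
  msym (tperm i j) (schubert u) = schubert u.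
Proof.
move=> ji uij; rewrite -[u](comp_perm_tpermK u i j) schubert_desc //.
  by rewrite msym_ddiff // -val_eqE /= ji; lia.
by rewrite !comp_permE tpermL tpermR.
Qed.

(** * A product formula *)

Section Layout.
Variables (n : nat) (blk : 'I_n -> nat) (G : pred 'I_n).
Hypothesis blk_mono : forall a b : 'I_n, (a < b)%N -> (blk a <= blk b)%N.
Hypothesis G_mono : forall a b : 'I_n, (a < b)%N -> blk a = blk b -> G a -> G b.

(** The blocks are inverted with each other, and each block is the direct sum of
    its part outside [G] and its part in [G]. *)
Definition laid_out (x : 'S_n) : Prop :=
  forall a b : 'I_n, (a < b)%N ->
    (blk a != blk b -> (x b < x a)%N) /\
    (blk a = blk b -> G a != G b -> (x a < x b)%N).

Definition inner_inversions (I : pred 'I_n) (x u : 'S_n) : Prop :=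
  forall a b : 'I_n, (a < b)%N -> blk a = blk b -> G a = G b ->
    (x b < x a)%N = I a && (u b < u a)%N.

Section Adjacent.
Variables (i j : 'I_n).
Hypotheses (ji : j = i.+1 :> nat) (bij : blk i = blk j).
Let s := tperm i j.

Lemma laid_out_tperm x : G i = G j -> laid_out x -> laid_out (comp_perm x s).
Proof.
move=> Gij xl a b ab; rewrite !comp_permE.
have blks k : blk (s k) = blk k by rewrite /s; case: tpermP => [->|->|].
have Gs k : G (s k) = G k by rewrite /s; case: tpermP => [->|->|].
have [[-> ->]|abij] := eqVneq (a, b) (i, j); first by rewrite bij Gij !eqxx.
by have := xl _ _ (tperm_adjacent_lt ji ab abij); rewrite -/s !blks !Gs.
Qed.

Lemma inner_inversions_tperm (I : pred 'I_n) x u : G i = G j -> I i = I j ->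
  I i -> inner_inversions I x u -> (u j < u i)%N ->
  inner_inversions I (comp_perm x s) (comp_perm u s).
Proof.
move=> Gij Iij Ii xI uji a b ab bab Gab; rewrite !comp_permE.
have blks k : blk (s k) = blk k by rewrite /s; case: tpermP => [->|->|].
have Gs k : G (s k) = G k by rewrite /s; case: tpermP => [->|->|].
have Is k : I (s k) = I k by rewrite /s; case: tpermP => [->|->|].
have [[-> ->]|abij] := eqVneq (a, b) (i, j).
  rewrite /s tpermL tpermR (perm_lt_neq x) -?val_eqE /=; last by lia.
  rewrite xI ?ji // Ii uji andTb; apply/esym/negbTE; rewrite -leqNgt ltnW //.
by have := xI _ _ (tperm_adjacent_lt ji ab abij); rewrite -/s !blks !Gs !Is; apply.
Qed.

Lemma inner_inversions_tperm_out (I : pred 'I_n) x u : G i = G j ->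
  (forall k, blk k = blk i -> G k = G i -> ~~ I k) ->
  inner_inversions I x u -> inner_inversions I x (comp_perm u s).
Proof.
move=> Gij nI xI a b ab bab Gab; rewrite xI // !comp_permE.
have [->|ia] := eqVneq a i; first by rewrite (negPf (nI _ _ _)).
have [ja|ja] := eqVneq a j; first by rewrite (negPf (nI _ _ _)) ?ja.
have [E|ib] := eqVneq b i; first by rewrite (negPf (nI _ _ _)) ?bab ?Gab ?E.
have [E|jb] := eqVneq b j; first by rewrite (negPf (nI _ _ _)) ?bab ?Gab ?E.
by rewrite /s !tpermD // eq_sym.
Qed.

End Adjacent.

Definition blocks_after (l : 'I_n) : nat :=
  #|[set k : 'I_n | (l < k)%N && (blk k != blk l)]|.

Lemma ell_sorted_blocks (y : 'S_n) : laid_out y ->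
  inner_inversions pred0 y y -> ell y = (\sum_l blocks_after l)%N.
Proof.
move=> yl y0; rewrite /ell -sum1_card.
rewrite (eq_bigl (fun p : 'I_n * 'I_n => predT p.1 &&
    ((p.1 < p.2)%N && (blk p.2 != blk p.1)))) => [|[a b]].
  rewrite -(pair_big_dep predT (fun a b : 'I_n => (a < b)%N && (blk b != blk a))
    (fun _ _ => 1%N)) /=.
  by apply: eq_bigr => l _; rewrite /blocks_after -sum1_card; apply: eq_bigl => k;
    rewrite inE.
rewrite inE /=; case: (boolP (a < b)%N) => //= ab; have [bl inb] := yl _ _ ab.
have [E|ne] := eqVneq (blk a) (blk b); last by rewrite bl // eq_sym ne.
rewrite /=; have [GE|/(inb E)] := eqVneq (G a) (G b); first by rewrite y0.
by lia.
Qed.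

(** The difference [D] of the two sides is killed by the divided differences inside
    the blocks, by induction on the length: such a divided difference acts on one
    factor of each side, the other one being symmetric. So [D] is symmetric in the
    variables of each block. At the last variable of a block the staircase bounds
    the exponents by twice the number of later positions; by symmetry this bounds
    all exponents, so the degree of [D] is at most twice the length of [y]. But
    [D] is homogeneous of larger degree, unless [u] is sorted as well. *)
Lemma schubert_product (u al be y : 'S_n) :
  laid_out u -> laid_out al -> laid_out be -> laid_out y ->
  inner_inversions pred0 y u -> inner_inversions (fun c => ~~ G c) al u ->
  inner_inversions G be u ->
  schubert u * schubert y = schubert al * schubert be.
Proof.
move=> + + + yl; have [m] := ubnP (ell u); elim: m u al be => // m IH u al be um.
move=> ul al_l bel y0 alI beI.
pose D := schubert u * schubert y - schubert al * schubert be.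
suff : D = 0 by move/eqP; rewrite subr_eq0 => /eqP.
have inv_le (x : 'S_n) : laid_out x -> inversions y \subset inversions x.
  move=> xl; apply/subsetP=> -[a b]; rewrite !inE /= => /andP[ab yba]; rewrite ab /=.
  have [xb _] := xl _ _ ab; have [_ yb] := yl _ _ ab.
  have [E|/xb//] := eqVneq (blk a) (blk b).
  have [GE|/(yb E)] := eqVneq (G a) (G b); last by lia.
  by move: yba; rewrite y0.
have ell_y : (\sum_l blocks_after l = ell y)%N.
  by rewrite ell_sorted_blocks // => a b ab bab Gab; rewrite y0.
have comp_eq (x : 'S_n) (I : pred 'I_n) : laid_out x -> inner_inversions I x u ->
    (forall a b : 'I_n, (a < b)%N -> blk a = blk b -> G a = G b -> (u a < u b)%N) ->
    x = u.
  move=> xl xI noinv; apply: perm_lt_inj => a b ab.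
  have ab' : a != b by rewrite -val_eqE /=; lia.
  have [ub1 ub2] := ul _ _ ab; have [xb1 xb2] := xl _ _ ab.
  have [E|ne] := eqVneq (blk a) (blk b).
    have [GE|GE] := eqVneq (G a) (G b); last by rewrite ub2 ?xb2.
    have lt := noinv _ _ ab E GE; rewrite (perm_lt_neq x) // xI // lt.
    by rewrite (_ : (u b < u a)%N = false) ?andbF //; lia.
  by have := ub1 ne; have := xb1 ne; lia.
have [/existsP[a /existsP[b /and5P[ab bab Gab _ uba]]]|noinv] := boolP
  [exists a : 'I_n, exists b : 'I_n, [&& (a < b)%N, blk a == blk b, G a == G b,
    true & (u b < u a)%N]]; last first.
  have noinv' (a b : 'I_n) : (a < b)%N -> blk a = blk b -> G a = G b -> (u a < u b)%N.
    move=> ab bab Gab; rewrite perm_lt_neq -?val_eqE /=; last by lia.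
    apply: contra noinv => uba; apply/existsP; exists a; apply/existsP; exists b.
    by rewrite ab bab Gab !eqxx.
  rewrite /D (comp_eq al _ al_l alI noinv') (comp_eq be _ bel beI noinv').
  by rewrite (comp_eq y _ yl y0 noinv') subrr.
move/eqP in bab; move/eqP in Gab.
have lt_inv (x : 'S_n) : laid_out x -> (x b < x a)%N -> (ell y < ell x)%N.
  move=> xl xba; apply/proper_card/properP; split; first exact: inv_le.
  by exists (a, b); rewrite !inE /= ab ?xba // y0.
have symD (i j : 'I_n) : j = i.+1 :> nat -> blk i = blk j -> msym (tperm i j) D = D.
  move=> ji bij; have ij : i != j by rewrite -val_eqE /= ji; lia.
  have ij' : (i < j)%N by rewrite ji.
  have asc (x : 'S_n) I : laid_out x -> inner_inversions I x u ->
      ~~ (I i && (u j < u i)%N) -> (x i < x j)%N.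
    move=> xl xI nI; have [_ xb] := xl _ _ ij'.
    have [GE|/(xb bij)//] := eqVneq (G i) (G j).
    by rewrite (perm_lt_neq x) // xI.
  have yasc : (y i < y j)%N by apply: asc yl y0 _.
  have [uij|uji] := boolP (u i < u j)%N.
    have nuji : ~~ (u j < u i)%N by rewrite -leqNgt ltnW.
    rewrite /D msymB !msymM !msym_schubert //.
    - by apply: asc bel beI _; rewrite negb_and nuji orbT.
    by apply: asc al_l alI _; rewrite negb_and nuji orbT.
  rewrite (perm_lt_neq u) // negbK in uji.
  have Gij : G i = G j.
    apply/eqP; apply: contraTT uji => /(proj2 (ul _ _ ij') bij) ?.
    by rewrite -leqNgt ltnW.
  suff D0 : ddiff i j D = 0.
    by have := ddiffP i j D; rewrite D0 mul0r => /esym/eqP; rewrite subr_eq0 => /eqP.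
  have um' : (ell (comp_perm u (tperm i j)) < m)%N.
    have : (ell (comp_perm u (tperm i j)) < ell u)%N by rewrite ell_descent.
    by move: um; lia.
  have ul' := laid_out_tperm ji bij Gij ul.
  have y0' : inner_inversions pred0 y (comp_perm u (tperm i j)).
    by move=> c d cd bcd Gcd; rewrite y0.
  rewrite /D ddiffD // ddiffN // ddiffMr ?msym_schubert // -schubert_desc //.
  have [Gi|nGi] := boolP (G i).
    rewrite [schubert al * _]mulrC ddiffMr ?msym_schubert //; last first.
      by apply: asc al_l alI _; rewrite /= Gi.
    rewrite -schubert_desc //; last by rewrite beI // Gi uji.
    rewrite [X in _ - X]mulrC (IH _ al (comp_perm be (tperm i j))) ?subrr //.
    - exact: laid_out_tperm.
    - apply: inner_inversions_tperm_out => // k _ Gk /=.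
      by rewrite Gk Gi.
    by apply: inner_inversions_tperm => //; rewrite Gij.
  rewrite ddiffMr ?msym_schubert //; last first.
    by apply: asc bel beI _; rewrite (negPf nGi).
  rewrite -schubert_desc //; last by rewrite alI //= nGi uji.
  rewrite (IH _ (comp_perm al (tperm i j)) be) ?subrr //.
  - exact: laid_out_tperm.
  - by apply: inner_inversions_tperm => //=; rewrite Gij.
  by apply: inner_inversions_tperm_out => // k _ ->.
have bound mm : mm \in msupp D -> (forall l, mm l <= (n.-1 - l).*2)%N /\
    (ell y + ell y < mdeg mm)%N.
  move=> /msuppB_le; rewrite mem_cat.
  move=> /orP[] /msuppM_le/allpairsP[[m1 m2] /= [m1P m2P ->]];
  have [d1 b1] := msupp_schubert m1P; have [d2 b2] := msupp_schubert m2P;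
  (split; first by move=> l; rewrite mnmDE; have := b1 l; have := b2 l; lia);
  rewrite mdegD d1 d2; first by have := lt_inv u ul uba; lia.
  have ley x : laid_out x -> (ell y <= ell x)%N.
    by move=> /inv_le/subset_leq_card.
  have := ley _ al_l; have := ley _ bel; have [Ga|nGa] := boolP (G a).
    by have := lt_inv be bel; rewrite beI // Ga uba => /(_ isT); lia.
  by have := lt_inv al al_l; rewrite alI //= nGa uba => /(_ isT); lia.
have bound2 mm l : mm \in msupp D -> (mm l <= (blocks_after l).*2)%N.
  have [d] := ubnP (n - l); elim: d => // d IHd in mm l *; move=> dl mmD.
  have last_case : (forall k : 'I_n, (l < k)%N -> blk k != blk l) ->
      (mm l <= (blocks_after l).*2)%N.
    move=> lastl; have [/(_ l) + _] := bound _ mmD; rewrite -card_gt_ord.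
    rewrite (_ : #|_| = blocks_after l) //; apply: eq_card => k.
    by rewrite !inE; case: (boolP (l < k)%N) => // /lastl ->.
  have [l1|ln] := ltnP l.+1 n; last first.
    by apply: last_case => k lk; have := ltn_ord k; lia.
  pose j := Ordinal l1; have [bj|bj] := eqVneq (blk l) (blk j); last first.
    apply: last_case => k lk; have := blk_mono (_ : l < j)%N => /(_ (ltnSn _)).
    have [->|kj] := eqVneq k j; first by rewrite eq_sym.
    have : (j < k)%N by move: kj; rewrite -val_eqE /=; lia.
    by move/blk_mono; lia.
  have mm'D : [multinom mm (tperm l j k) | k < n] \in msupp D.
    by rewrite mcoeff_msupp -mcoeff_sym symD // -mcoeff_msupp.
  have /= := IHd _ j _ mm'D; rewrite mnmE tpermR => /(_ _).
  rewrite (_ : blocks_after j = blocks_after l); first by apply; lia.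
  apply: eq_card => k; rewrite !inE -bj /=.
  have [->|kj] := eqVneq k j; first by rewrite bj eqxx !andbF.
  by move: kj; rewrite -val_eqE /= => kj; case: eqP => _; rewrite ?andbF ?andbT; lia.
case E : (msupp D) => [|mm ?]; first exact: msuppnil0 E.
have mmD : mm \in msupp D by rewrite E mem_head.
have [_] := bound _ mmD; rewrite ltnNge => /negP[].
rewrite mdegE addnn -ell_y -muln2 big_distrl /=; apply: leq_sum => l _.
by rewrite muln2 bound2.
Qed.

End Layout.

(** * Permutations avoiding 1324, 2413 and 3142 *)

Definition noninv n (u : 'S_n) (i j : 'I_n) : bool :=
  (i < j)%N == (u i < u j)%N.

Lemma noninvC n (u : 'S_n) (i j : 'I_n) : noninv u i j = noninv u j i.
Proof.
rewrite /noninv; have [->//|ij] := eqVneq i j.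
rewrite !(perm_lt_neq _ ij) (_ : (i < j)%N = ~~ (j < i)%N);
  by move: ij; rewrite -?val_eqE /=; case: (u j < u i)%N; lia.
Qed.

Lemma noninvP n (u : 'S_n) (i j : 'I_n) : noninv u i j ->
  [\/ i = j, (i < j)%N /\ (u i < u j)%N | (j < i)%N /\ (u j < u i)%N].
Proof.
have [->|ij] := eqVneq i j; first by constructor 1.
rewrite /noninv => E; have uij := perm_lt_neq u ij.
have [lt|lt] : ((i < j) \/ (j < i))%N by move: ij; rewrite -val_eqE /=; lia.
  by constructor 2; split=> //; move: E; rewrite lt; lia.
by constructor 3; split=> //; move: E; rewrite ltnNge (ltnW lt); lia.
Qed.

Lemma invP n (u : 'S_n) (i j : 'I_n) : ~~ noninv u i j ->
  ((i < j)%N /\ (u j < u i)%N) \/ ((j < i)%N /\ (u i < u j)%N).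
Proof.
have [->|ij] := eqVneq i j; first by rewrite /noninv !ltnn eqxx.
rewrite /noninv => E; have uij := perm_lt_neq u ij.
have [lt|lt] : ((i < j) \/ (j < i))%N by move: ij; rewrite -val_eqE /=; lia.
  by left; split=> //; move: E; rewrite lt; lia.
by right; split=> //; move: E; rewrite ltnNge (ltnW lt); lia.
Qed.

Section Separable.
Variables (n : nat) (u : 'S_n).
Hypothesis avu : avoids u [:: [:: 1; 3; 2; 4]; [:: 2; 4; 1; 3]; [:: 3; 1; 4; 2]]%N.
Implicit Types a b c d i j k m p q e : 'I_n.
Local Notation N := (noninv u).

Lemma noninv_P4free a b c d : N a b -> N b c -> N c d ->
  [|| N a c, N b d | N a d].
Proof.
move=> ab bc cd; apply: contraT; rewrite !negb_or => /and3P[ac bd ad].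
have [abE|ab'|ab'] := noninvP ab; first by move: ac; rewrite abE bc.
all: have [bcE|bc'|bc'] := noninvP bc; first by move: ac; rewrite -bcE ab.
all: have [cdE|cd'|cd'] := noninvP cd; first by move: bd; rewrite -cdE bc.
all: case: (invP ac) => ac'; case: (invP bd) => bd'; try lia.
all: case: (invP ad) => ad'; try lia.
- by occ [:: 3; 1; 4; 2]%N [:: a; c; b; d].
- by occ [:: 2; 4; 1; 3]%N [:: c; d; a; b].
- by occ [:: 2; 4; 1; 3]%N [:: b; a; d; c].
by occ [:: 3; 1; 4; 2]%N [:: d; b; c; a].
Qed.

(** Connection in the graph of non-inversions: as this graph has no induced path on
    four vertices, connected vertices are at distance at most two. *)
Definition linked i j : bool := [exists k, N i k && N k j].

Lemma noninvxx i : N i i.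
Proof. by rewrite /noninv !ltnn. Qed.

Lemma noninv_linked i j : N i j -> linked i j.
Proof. by move=> ij; apply/existsP; exists j; rewrite ij noninvxx. Qed.

Lemma linkedC i j : linked i j = linked j i.
Proof.
by apply/existsP/existsP => -[k /andP[ik kj]]; exists k;
  rewrite noninvC kj noninvC ik.
Qed.

Lemma linked_trans i j l : linked i j -> linked j l -> linked i l.
Proof.
move=> /existsP[k /andP[ik kj]] /existsP[m /andP[jm ml]].
have path3 a b c d : N a b -> N b c -> N c d -> linked a d.
  move=> ab bc cd; apply/existsP; have := noninv_P4free ab bc cd.
  case/or3P => H; [exists c | exists b | exists a]; rewrite ?H ?ab ?cd ?noninvxx //.
have /or3P[H|H|H] := noninv_P4free ik kj jm.
- exact: path3 H jm ml.
- exact: path3 ik H ml.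
by apply/existsP; exists m; rewrite H ml.
Qed.

Lemma linked_between i k j : (i < k)%N -> (k < j)%N -> linked i j -> linked k j.
Proof.
move=> ik kj ij; have [/noninv_linked ->//|/invP kjI] := boolP (N k j).
have [/noninv_linked ik'|/invP ikI] := boolP (N i k).
  by apply: linked_trans ij; rewrite linkedC.
have /existsP[m /andP[im mj]] := ij; apply/existsP; exists m; rewrite mj andbT.
rewrite /noninv; have [E|im'|im'] := noninvP im;
  by have [E'|mj'|mj'] := noninvP mj; subst; lia.
Qed.

(** The classes of [linked] are intervals of positions, and the number of positions
    before the class serves as its label. *)
Definition block i : nat := #|[set k : 'I_n | (k < i)%N && ~~ linked k i]|.

Lemma block_linked i j : (i < j)%N -> linked i j -> block i = block j.
Proof.
move=> ij lij; apply: eq_card => k; rewrite !inE; have [ki|ik] := ltnP k i.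
  rewrite (ltn_trans ki ij) /=; congr (~~ _); apply/idP/idP => H.
    exact: linked_trans lij.
  by apply: linked_trans H _; rewrite linkedC.
apply/esym/negbTE; rewrite negb_and negbK -leqNgt.
case: (ltnP k j) => //= kj; move: ik.
rewrite leq_eqVlt => /orP[/eqP/ord_inj <- //|ik].
exact: linked_between kj lij.
Qed.

Lemma block_unlinked i j : (i < j)%N -> ~~ linked i j -> (block i < block j)%N.
Proof.
move=> ij nij; apply/proper_card/properP; split; last first.
  by exists i; rewrite !inE ?ij ?nij // ltnn.
apply/subsetP=> k; rewrite !inE => /andP[ki nki]; rewrite (ltn_trans ki ij) /=.
by apply: contra nij => kj; apply: linked_between kj.
Qed.

Lemma block_eq i j : (block i == block j) = linked i j.
Proof.
have main a b : (a < b)%N -> (block a == block b) = linked a b.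
  move=> ab; have [/(block_linked ab) ->|/(block_unlinked ab)] := boolP (linked a b).
    by rewrite eqxx.
  by case: ltngtP.
case: (ltngtP (nat_of_ord i) (nat_of_ord j)) => [/main //|/main|/ord_inj ->].
  by rewrite eq_sym linkedC.
by rewrite eqxx noninv_linked ?noninvxx.
Qed.

Lemma block_mono i j : (i < j)%N -> (block i <= block j)%N.
Proof.
move=> ij; have [lij|nij] := boolP (linked i j); first by rewrite (block_linked ij).
exact/ltnW/block_unlinked.
Qed.

(** The entries that are the 3 or the 2 of an occurrence of 132; they form the
    second summand of each block. *)
Definition upper c : bool := [exists m : 'I_n, [exists p : 'I_n,
  [&& (m < c)%N, (u m < u c)%N, (m < p)%N, (u m < u p)%N & ~~ N p c]]].

Lemma upperP c : reflect (exists m p : 'I_n, [/\ (m < c)%N, (u m < u c)%N, (m < p)%N,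
  (u m < u p)%N & ~~ N p c]) (upper c).
Proof.
apply: (iffP existsP) => -[m H]; exists m.
  by case/existsP: H => p /and5P ?; exists p.
by case: H => p /and5P ?; apply/existsP; exists p.
Qed.

(** An upper entry is neither the 2 nor the 1 of a 213: the two occurrences would
    combine to a 1324, or else to a 2413 or a 3142. *)
Lemma upper_no213 c e q : upper c ->
  (c < e -> u c < u e -> q < e -> u q < u e -> ~~ N q c -> False)%N.
Proof.
move=> /upperP[m [p [mc mc' mp mp' pc]]] ce ce' qe qe' qc.
case: (invP pc) (invP qc) => pc' [] qc'.
- cmp_pos m q; first by occ [:: 1; 3; 2; 4]%N [:: m; q; c; e].
  cmp_val u p e; first by occ [:: 1; 3; 2; 4]%N [:: m; p; c; e].
  by occ [:: 2; 4; 1; 3]%N [:: q; p; c; e].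
- cmp_val u m q; first by occ [:: 1; 3; 2; 4]%N [:: m; c; q; e].
  cmp_val u p e; first by occ [:: 1; 3; 2; 4]%N [:: m; p; c; e].
  by occ [:: 2; 4; 1; 3]%N [:: m; p; q; e].
- cmp_pos m q; first by occ [:: 1; 3; 2; 4]%N [:: m; q; c; e].
  cmp_pos p e; first by occ [:: 1; 3; 2; 4]%N [:: m; c; p; e].
  by occ [:: 3; 1; 4; 2]%N [:: q; m; e; p].
cmp_val u m q; first by occ [:: 1; 3; 2; 4]%N [:: m; c; q; e].
cmp_pos p e; first by occ [:: 1; 3; 2; 4]%N [:: m; c; p; e].
by occ [:: 2; 4; 1; 3]%N [:: m; c; q; p].
Qed.

(** Two inverted entries of a block lie both above a common smaller entry to their
    left, or both below a common larger entry to their right. In the first case both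
    are upper, and in the second neither is. *)
Lemma block_layout i j : block i = block j -> ~~ upper i -> upper j ->
  (i < j)%N /\ (u i < u j)%N.
Proof.
move=> /eqP; rewrite block_eq => /existsP[k /andP[ik kj]] nUi Uj.
have nU m p : (m < i -> u m < u i -> m < p -> u m < u p -> N p i)%N.
  by move=> *; apply: contraR nUi => ?; apply/upperP; exists m, p.
have [ij|ij] := boolP (N i j).
  case: (noninvP ij) => [E|//|[ji ji']]; first by move: nUi; rewrite E Uj.
  have /upperP[m [p [mj mj' mp mp' pj]]] := Uj; exfalso.
  have pi : N p i by apply: (nU m p); lia.
  case: (noninvP pi) (invP pj) => [E|[pi1 pi2]|[pi1 pi2]] [[pj1 pj2]|[pj1 pj2]];
    try by subst; lia.
  - by occ [:: 1; 3; 2; 4]%N [:: m; p; j; i].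
  by occ [:: 1; 3; 2; 4]%N [:: m; j; p; i].
have ji : ~~ N j i by rewrite noninvC.
have ne a b : ~~ N a b -> a <> b by move=> ab E; move: ab; rewrite E noninvxx.
case: (noninvP ik) (noninvP kj) => [E|[k1 k2]|[k1 k2]] [E'|[k3 k4]|[k3 k4]].
all: try by [move: ij; rewrite E kj | move: ij; rewrite -E' ik].
- by case: (invP ij); lia.
- by exfalso; apply: (upper_no213 (c := j) (e := k) (q := i)).
- by move: ji; rewrite (nU k j).
by case: (invP ij); lia.
Qed.

Lemma upper_le i j : (i < j)%N -> block i = block j -> upper i -> upper j.
Proof.
move=> ij bij Ui; apply: contraT => nUj.
by have [] := block_layout (esym bij) nUj Ui; lia.
Qed.

Lemma separable_laid_out : laid_out block upper u.
Proof.
move=> a b ab; split=> [nab|bab Uab].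
  rewrite block_eq in nab; have : ~~ N a b by apply: contra nab; apply: noninv_linked.
  by move/invP; lia.
have [Ua|nUa] := boolP (upper a).
  by have Ub := upper_le ab bab Ua; rewrite Ua Ub eqxx in Uab.
apply: (proj2 (block_layout bab nUa _)).
by move: Uab; rewrite (negPf nUa); case: (upper b).
Qed.

End Separable.

(** * Determinants for permutations avoiding 1324, 2413 and 3142 *)

(** Divided differences lead from any Schubert polynomial to that of the identity,
    whose determinant is unitriangular. *)
Lemma schubert_neq0 n (u : 'S_n) : schubert u != 0.
Proof.
have [m] := ubnP (ell u); elim: m u => // m IH u um.
have [/existsP[i /existsP[j /andP[/eqP ji uji]]]|nodesc] := boolP
  [exists i : 'I_n, exists j : 'I_n, (j == i.+1 :> nat) && (u j < u i)%N].
  have ij : i != j by rewrite -val_eqE /= ji; lia.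
  have : schubert (comp_perm u (tperm i j)) != 0.
    have : (ell (comp_perm u (tperm i j)) < ell u)%N by rewrite ell_descent.
    by move=> lt; apply: IH; move: um lt; lia.
  by rewrite schubert_desc //; apply: contraNneq => ->; rewrite ddiff0.
have u1 : u = 1%g.
  have inc : forall i j : 'I_n, (i < j)%N -> (u i < u j)%N.
    move=> i j ij; apply: (@adjacent_chain n (fun i j => u i < u j)%N 0 n) => //.
    - by move=> y x z; apply: ltn_trans.
    - move=> i' j' ji _ _; rewrite perm_lt_neq -?val_eqE /= ?ji; last by lia.
      apply: contra nodesc => uji; apply/existsP; exists i'; apply/existsP; exists j'.
      by rewrite ji eqxx.
    exact/ltnW/ltn_ord.
  by apply: perm_lt_inj => i j ij; rewrite inc // !perm1.
have [e ->] : represented u (block_code (fun=> 0%N) u).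
  apply: represented_no132 => // a b c ab bc; rewrite u1 !perm1; lia.
rewrite mulf_neq0 ?signr_eq0 //.
have -> : schubert_det (block_code (fun=> 0%N) u) = 1; last by rewrite oner_eq0.
have code0 c : block_code (fun=> 0%N) u c = 0%N.
  apply/eqP; rewrite cards_eq0; apply/eqP/setP=> k; rewrite !inE eqxx u1 !perm1; lia.
rewrite /schubert_det coef_detE det_trig; last first.
  apply/is_trig_mxP=> c a ca; rewrite mxE code0 expr0 mul1r nth_default //.
  by rewrite size_lattice_poly.
rewrite big1 // => c _; rewrite mxE code0 expr0 mul1r.
have /monicP := monic_lattice_poly (@xvar n) c.
by rewrite lead_coefE size_lattice_poly.
Qed.

(** Replacing the columns [Fy c], [c] outside [I], by the combinations [Fa c] of
    these columns multiplies the determinant by a factor that does not depend on the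
    columns in [I]. *)
Lemma coef_det_exchange (R : comNzRingType) n (I : pred 'I_n)
    (Fu Fa Fb Fy : 'I_n -> {poly R}) :
  (forall c, I c -> Fu c = Fb c /\ Fa c = Fy c) ->
  (forall c, ~~ I c -> Fu c = Fa c /\ Fb c = Fy c) ->
  (forall c, ~~ I c -> exists t : 'I_n -> R,
     Fa c = \sum_(k | ~~ I k) t k *: Fy k) ->
  coef_det Fu * coef_det Fy = coef_det Fa * coef_det Fb.
Proof.
move=> FI FnI span.
have /fin_all_exists[t tP] : forall c, exists t : 'I_n -> R,
    ~~ I c -> Fa c = \sum_(k | ~~ I k) t k *: Fy k.
  move=> c; have [Ic|/span[t tE]] := boolP (I c); last by exists t.
  by exists (fun=> 0).
pose T := \matrix_(c, k) if I c then (c == k)%:R else if I k then 0 else t c k.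
have TE (F G : 'I_n -> {poly R}) : (forall c, I c -> F c = G c) ->
    (forall c, ~~ I c -> Fa c = F c /\ Fy c = G c) ->
    coef_det F = \det T * coef_det G.
  move=> FG1 FG2; rewrite !coef_detE -det_mulmx; congr (\det _).
  apply/matrixP=> c a; rewrite !mxE; have [Ic|nIc] := boolP (I c).
    rewrite (bigD1 c) //= !mxE Ic eqxx mul1r FG1 // big1 ?addr0 // => k kc.
    by rewrite !mxE Ic eq_sym (negPf kc) mul0r.
  have [<- _] := FG2 c nIc; rewrite tP // coef_sum [RHS](bigID I) /=.
  rewrite [X in _ = X + _]big1 ?add0r => [|k Ik]; last first.
    by rewrite !mxE (negPf nIc) Ik mul0r.
  apply: eq_bigr => k nIk; rewrite !mxE (negPf nIc) (negPf nIk) coefZ.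
  by have [_ <-] := FG2 k nIk.
have -> : coef_det Fu = \det T * coef_det Fb.
  by apply: TE => c Ic; [have [] := FI c Ic | have [-> ->] := FnI c Ic].
have -> : coef_det Fa = \det T * coef_det Fy.
  by apply: TE => c Ic //; have [] := FI c Ic.
by rewrite mulrAC.
Qed.

Lemma card_between n (A : {set 'I_n}) c d :
  (forall k, k \in A -> (c < k)%N && (k < d)%N) -> (#|A| <= d - c.+1)%N.
Proof.
move=> Acd; rewrite cardE -(size_map val) -(size_iota c.+1 (d - c.+1)).
apply: uniq_leq_size; first by rewrite map_inj_uniq ?enum_uniq //; apply: val_inj.
by move=> _ /mapP[k + ->]; rewrite mem_enum mem_iota => /Acd /=; lia.
Qed.

Section Representation.
Variables (n : nat) (blk : 'I_n -> nat) (G : pred 'I_n).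
Hypothesis blk_mono : forall a b : 'I_n, (a < b)%N -> (blk a <= blk b)%N.
Hypothesis G_mono : forall a b : 'I_n, (a < b)%N -> blk a = blk b -> G a -> G b.
Local Notation P := (lattice_poly (@xvar n)).

(** A column of the first part of a block has height plus exponent within that
    part, so it lies in the span of the columns of the sorted part. *)
Lemma span_block (al : 'S_n) (c : 'I_n) (kap : 'I_n -> nat) :
  laid_out blk G al -> ~~ G c -> (forall k, blk k = blk c -> kap k = kap c) ->
  exists t : 'I_n -> {mpoly int[n]},
    'X^(kap c + #|[set k : 'I_n |
         [&& blk k == blk c, (c < k)%N & (al k < al c)%N]]|) * P c =
    \sum_(k | ~~ G k) t k *: ('X^(kap k) * P k).
Proof.
set A := [set k | _] => al_l nGc kapE; set e := #|A|.
have [tau E] := lattice_polyXn (@xvar n) c e.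
have A_G k : k \in A -> ~~ G k.
  rewrite inE => /and3P[/eqP kc ck alk]; have [_ /(_ (esym kc))] := al_l _ _ ck.
  by case: (G k) (G c) nGc alk => [] [] //= _ alk /(_ isT); lia.
have seg t (te : (t <= e)%N) : exists2 k : 'I_n, k = (c + t)%N :> nat &
    (blk k == blk c) && ~~ G k.
  have [->|t_gt0] := posnP t; first by exists c; rewrite ?addn0 ?eqxx.
  have [/existsP[k /andP[kA ctk]]|noA] :=
    boolP [exists k : 'I_n, (k \in A) && (c + t <= k)%N].
    have ctn : (c + t < n)%N by apply: leq_ltn_trans ctk (ltn_ord k).
    have nGk := A_G k kA; move: kA; rewrite inE => /and3P[/eqP kc ck _].
    exists (Ordinal ctn) => //; set k0 := Ordinal ctn.
    have ck0 : (c < k0)%N by rewrite /=; lia.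
    have [->|k0k] := eqVneq k0 k; first by rewrite kc eqxx.
    have {}k0k : (k0 < k)%N by move: k0k; rewrite -val_eqE /=; lia.
    have b0 : blk k0 = blk c.
      by have := blk_mono ck0; have := blk_mono k0k; lia.
    by rewrite b0 eqxx; apply: contra nGk; apply: G_mono k0k _; rewrite b0 kc.
  have : (#|A| <= c + t - c.+1)%N; last by rewrite -/e; lia.
  apply: card_between => k kA; move: (kA); rewrite inE => /and3P[_ -> _] /=.
  rewrite ltnNge; apply: contra noA => ctk; apply/existsP; exists k; exact/andP.
have lt (t : 'I_e.+1) : (c + t < n)%N.
  by have [k <- _] := seg t (leq_ord t); apply: ltn_ord.
pose h t := Ordinal (lt t).
have hP t : (blk (h t) == blk c) && ~~ G (h t).
  by have [k kt] := seg t (leq_ord t); rewrite (_ : h t = k) //; apply: ord_inj.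
pose R (k : 'I_n) := (c <= k <= c + e)%N.
exists (fun k => if R k then tau (k - c)%N else 0).
rewrite exprD -mulrA E mulr_sumr.
rewrite (eq_bigr (fun k : 'I_n => if R k
  then tau (k - c)%N *: ('X^(kap k) * P k) else 0)) => [|k _]; last first.
  by case: ifP; rewrite ?scale0r.
rewrite -big_mkcondr.
rewrite (reindex_onto h (fun k => inord (k - c))) => [|k /andP[_]]; last first.
  by move=> /andP[ck ke]; apply: ord_inj; rewrite /= inordK; lia.
apply: eq_big => t.
  have /andP[_ ->] := hP t; rewrite /R /= leq_addr leq_add2l leq_ord /=.
  by apply/esym/eqP/ord_inj; rewrite addKn inordK.
move=> _; have /andP[/eqP bh _] := hP t.
by rewrite -scalerAr /= addKn kapE.
Qed.

Lemma represented_layout (u al be y : 'S_n) (bu ba bb b0 : 'I_n -> nat) :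
  laid_out blk G u -> laid_out blk G al -> laid_out blk G be -> laid_out blk G y ->
  inner_inversions blk G pred0 y u ->
  inner_inversions blk G (fun c => ~~ G c) al u ->
  inner_inversions blk G G be u ->
  represented al ba -> represented be bb -> represented y b0 ->
  (forall c, G c -> bu c = bb c /\ ba c = b0 c) ->
  (forall c, ~~ G c -> bu c = ba c /\ bb c = b0 c) ->
  (forall c k, blk k = blk c -> b0 k = b0 c) ->
  (forall c, ~~ G c -> ba c =
    (b0 c + #|[set k : 'I_n |
       [&& blk k == blk c, (c < k)%N & (al k < al c)%N]]|)%N) ->
  represented u bu.
Proof.
move=> ul al_l bel yl y0 alI beI [ea aE] [eb bE] [e0 yE] bG bnG b0blk baE.
have SS := schubert_product blk_mono ul al_l bel yl y0 alI beI.
have DD : schubert_det bu * schubert_det b0 = schubert_det ba * schubert_det bb.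
  apply: (@coef_det_exchange _ _ G) => c Gc.
  - by have [-> ->] := bG c Gc.
  - by have [-> ->] := bnG c Gc.
  by rewrite baE //; apply: span_block => // k; apply: b0blk.
exists (ea (+) eb (+) e0); apply: (mulIf (schubert_neq0 y)); rewrite SS aE bE yE.
rewrite !signr_addb.
transitivity ((-1) ^+ ea * (-1) ^+ eb * (schubert_det ba * schubert_det bb));
  first by ring.
have s0 : (-1) ^+ e0 * (-1) ^+ e0 = 1 :> {mpoly int[n]} by rewrite -expr2 sqrr_sign.
by rewrite -DD -[LHS]mulr1 -[X in _ * X]s0; ring.
Qed.

End Representation.

Lemma represented_separable n (u : 'S_n) :
  avoids u [:: [:: 1; 3; 2; 4]; [:: 2; 4; 1; 3]; [:: 3; 1; 4; 2]]%N ->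
  exists2 b, represented u b & forall c, (b c < n)%N.
Proof.
move=> avu; set blk := block u; set G := upper u.
have blk_mono (a b : 'I_n) : (a < b)%N -> (blk a <= blk b)%N by apply: block_mono.
have G_mono (a b : 'I_n) : (a < b)%N -> blk a = blk b -> G a -> G b.
  exact: upper_le.
have blk_lt c : (blk c < n)%N by apply: (card_lt_ord (c := c)); rewrite inE ltnn.
(* a permutation laid out like u, with a prescribed order inside each part; the
   key compares blocks first, then the parts, then f *)
have sorted_by (f : 'I_n -> nat) :
    (forall a b, G a = G b -> f a = f b -> a = b) -> (forall c, f c < n)%N ->
    exists2 x : 'S_n, laid_out blk G x &
    forall a b : 'I_n, (a < b)%N -> blk a = blk b -> G a = G b ->
      (x b < x a)%N = (f b < f a)%N.
  move=> f_inj f_lt.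
  pose key c := (((n - blk c).*2 + G c) * n + f c)%N.
  have key_lt a b : ((n - blk a).*2 + G a < (n - blk b).*2 + G b)%N ->
      (key a < key b)%N.
    move=> lt; rewrite /key; apply: (@leq_trans (((n - blk a).*2 + G a).+1 * n)).
      by rewrite mulSn addnC ltn_add2r.
    by rewrite (leq_trans _ (leq_addr _ _)) // leq_mul2r lt orbT.
  have key_eq a b : blk a = blk b -> G a = G b -> (key a < key b)%N = (f a < f b)%N.
    by move=> E GE; rewrite /key E GE ltn_add2l.
  have key_inj : injective key.
    move=> a b E; have [//|ab] := eqVneq a b; exfalso.
    case: (ltngtP ((n - blk a).*2 + G a) ((n - blk b).*2 + G b))%N
      => [/key_lt|/key_lt|].
    - by rewrite E ltnn.
    - by rewrite E ltnn.
    have := blk_lt a; have := blk_lt b => ba bb K.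
    have [bE GE] : blk a = blk b /\ G a = G b.
      by move: K; case: (G a); case: (G b) => /=; lia.
    have := key_eq a b bE GE; have := key_eq b a (esym bE) (esym GE); rewrite E ltnn.
    by case: (ltngtP (f a) (f b)) => // /(f_inj _ _ GE) E'; rewrite E' eqxx in ab.
  have [x xE] := perm_of_key key_inj; exists x => [a b ab|a b ab bE GE].
    rewrite !xE; split=> [ne|bE ne].
      apply: key_lt; have := blk_mono _ _ ab; have := blk_lt b.
      by case: (G a); case: (G b) => /=; lia.
    apply: key_lt; rewrite bE; have := G_mono _ _ ab bE.
    by case: (G a) ne; case: (G b) => //= _ Gab; [have := Gab isT | lia].
  by rewrite xE key_eq.
(* al sorts the upper entries of each block, be the other ones, and y both *)
have [al al_l alE] : exists2 x : 'S_n, laid_out blk G x &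
    forall a b : 'I_n, (a < b)%N -> blk a = blk b -> G a = G b ->
      (x b < x a)%N = ~~ G a && (u b < u a)%N.
  have [||x xl xE] := sorted_by (fun c => if G c then val c else val (u c)).
  - by move=> a b ->; case: ifP => _ /val_inj // /perm_inj.
  - by move=> c; case: ifP => _; apply: ltn_ord.
  exists x => // a b ab bE GE; rewrite xE // GE; case: ifP => //= _.
  by rewrite ltnNge ltnW.
have [be be_l beE] : exists2 x : 'S_n, laid_out blk G x &
    forall a b : 'I_n, (a < b)%N -> blk a = blk b -> G a = G b ->
      (x b < x a)%N = G a && (u b < u a)%N.
  have [||x xl xE] := sorted_by (fun c => if G c then val (u c) else val c).
  - by move=> a b ->; case: ifP => _ /val_inj // /perm_inj.
  - by move=> c; case: ifP => _; apply: ltn_ord.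
  exists x => // a b ab bE GE; rewrite xE // GE; case: ifP => //= _.
  by rewrite ltnNge ltnW.
have [y y_l yE] : exists2 x : 'S_n, laid_out blk G x &
    forall a b : 'I_n, (a < b)%N -> blk a = blk b -> G a = G b ->
      (x b < x a)%N = false.
  have [||x xl xE] := sorted_by val.
  - by move=> a b _ /val_inj.
  - by move=> c; apply: ltn_ord.
  by exists x => // a b ab bE GE; rewrite xE // ltnNge ltnW.
have same_blk (x : 'S_n) (a b : 'I_n) : laid_out blk G x -> (a < b)%N ->
    (x a < x b)%N -> blk a = blk b.
  by move=> xl ab xab; have [] := xl _ _ ab; case: eqVneq => // _ /(_ isT); lia.
have same_G (x : 'S_n) (a b : 'I_n) : laid_out blk G x -> (a < b)%N ->
    blk a = blk b -> (x b < x a)%N -> G a = G b.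
  move=> xl ab bE xba; have [_ /(_ bE)] := xl _ _ ab.
  by case: eqVneq => // _ /(_ isT); lia.
have al132 : no132 al.
  move=> a b c ab bc ac cb; have bac := same_blk _ _ _ al_l (ltn_trans ab bc) ac.
  have bab := same_blk _ _ _ al_l ab (ltn_trans ac cb).
  have bbc : blk b = blk c by rewrite -bab bac.
  have Gbc := same_G _ _ _ al_l bc bbc cb.
  have := cb; rewrite alE // => /andP[nGb ucb].
  have nGa : ~~ G a by apply: contra nGb; apply: G_mono.
  have Gab : G a = G b by rewrite (negPf nGa) (negPf nGb).
  move: nGb; rewrite Gbc => /negP[]; apply/(upperP u); exists a, b.
  have lt_u (d : 'I_n) : (a < d)%N -> blk a = blk d -> G a = G d ->
      (al a < al d)%N -> (u a < u d)%N.
    move=> ad bad Gad aad; rewrite perm_lt_neq -?val_eqE /=; last by lia.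
    by have := alE _ _ ad bad Gad; rewrite nGa /= => <-; rewrite -leqNgt ltnW.
  have ac' := ltn_trans ab bc; have ab' := ltn_trans ac cb.
  split=> //; [apply: lt_u => // | exact: lt_u |]; first by rewrite Gab.
  by rewrite /noninv bc ltnNge ltnW.
have be213 : no213 be.
  move=> a b c ab bc ba ac; have ac' := ltn_trans ab bc.
  have bac := same_blk _ _ _ be_l ac' ac.
  have bbc := same_blk _ _ _ be_l bc (ltn_trans ba ac).
  have bab : blk a = blk b by rewrite bac bbc.
  have Gab := same_G _ _ _ be_l ab bab ba.
  have := ba; rewrite beE // => /andP[Ga uba].
  have Gc : G c by apply: G_mono ac' bac Ga.
  have uac : (u a < u c)%N.
    rewrite perm_lt_neq -?val_eqE /=; last by lia.
    have := beE _ _ ac' bac (etrans Ga (esym Gc)); rewrite Ga /= => <-.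
    by rewrite -leqNgt ltnW.
  have nba : ~~ noninv u b a by rewrite /noninv uba ltnNge ltnW.
  by apply: (upper_no213 avu Ga ac' uac bc _ nba); apply: ltn_trans uac.
have y213 : no213 y.
  move=> a b c ab bc ba ac.
  have bac := same_blk _ _ _ y_l (ltn_trans ab bc) ac.
  have bbc := same_blk _ _ _ y_l bc (ltn_trans ba ac).
  have bab : blk a = blk b by rewrite bac bbc.
  by have := ba; rewrite yE // (same_G _ _ _ y_l ab bab ba).
pose before c := #|[set k : 'I_n | (blk k < blk c)%N]|.
have beforeE (x : 'S_n) (c : 'I_n) : laid_out blk G x ->
    (forall k : 'I_n, (k < c)%N -> blk k = blk c -> G k = G c ->
      (x c < x k)%N = false) ->
    larger_before x c = before c.
  move=> xl xE; apply: eq_card => k; rewrite !inE.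
  have [kc|ck] /= := ltnP k c; last first.
    rewrite ltnNge; move: ck.
    rewrite leq_eqVlt => /orP[/eqP/ord_inj->|/blk_mono ->//].
    by rewrite leqnn.
  have [xb xG] := xl _ _ kc; have := blk_mono _ _ kc.
  have [E _|ne] := eqVneq (blk k) (blk c); last by rewrite xb //; lia.
  rewrite E ltnn; have [GE|/(xG E)] := eqVneq (G k) (G c); first exact: xE.
  by move=> lt; apply/negbTE; rewrite -leqNgt ltnW.
pose bu c := if G c then larger_before be c else block_code blk al c.
have alcode c : block_code blk al c = (before c +
    #|[set k : 'I_n | [&& blk k == blk c, (c < k)%N & (al k < al c)%N]]|)%N.
  rewrite /block_code -(cardsID [set k | blk k == blk c]) addnC; congr (_ + _)%N.
    apply: eq_card => k; rewrite !inE; have [E|ne] /= := eqVneq (blk k) (blk c).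
      by rewrite E ltnn.
    have [kc|] := ltnP k c; first by have := blk_mono _ _ kc; lia.
    rewrite leq_eqVlt => /orP[/eqP/ord_inj E|/blk_mono]; last by lia.
    by rewrite E eqxx in ne.
  apply: eq_card => k; rewrite !inE; case: (blk k == blk c); last by rewrite andbF.
  by rewrite andbT.
have yb c : larger_before y c = before c.
  by apply: beforeE => // k kc bE GE; apply: yE.
exists bu; last first.
  move=> c; rewrite /bu; case: ifP => _; apply: (card_lt_ord (c := c)).
    by rewrite inE ltnn.
  by rewrite inE eqxx ltnn.
apply: (@represented_layout n blk G blk_mono G_mono u al be y bu
  (block_code blk al) (larger_before be) (larger_before y)) => //.
- exact: separable_laid_out.
- apply: represented_no132 => // a b ab; case: (al_l _ _ ab) => + _; exact.
- exact: represented_no213.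
- exact: represented_no213.
- move=> c Gc; rewrite /bu Gc yb alcode; split=> //.
  rewrite (_ : [set k | _] = set0) ?cards0 ?addn0 //; apply/setP=> k; rewrite !inE.
  apply/and3P=> -[/eqP kc ck]; have Gk := G_mono _ _ ck (esym kc) Gc.
  by rewrite alE // ?Gk // Gc.
- move=> c nGc; rewrite /bu (negPf nGc) yb; split=> //.
  apply: beforeE => // k kc bE GE.
  by rewrite beE // GE (negPf nGc).
- by move=> c k E; rewrite !yb /before E.
by move=> c nGc; rewrite yb alcode.
Qed.

(** * Lowering the ends of the paths *)

Definition prefix_intervals n (v : 'S_n) : Prop :=
  forall a b c : 'I_n, (a < c)%N -> (b < c)%N -> (v a < v c)%N -> (v c < v b)%N ->
  False.

Lemma avoids_prefix_intervals n (v : 'S_n) :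
  avoids v [:: [:: 1; 3; 2]; [:: 3; 1; 2]]%N -> prefix_intervals v.
Proof.
move=> avv a b c ac bc vac vcb.
cmp_pos a b; first by occ [:: 1; 3; 2]%N [:: a; b; c].
by occ [:: 3; 1; 2]%N [:: b; a; c].
Qed.

Lemma first_descent n (v : 'S_n) : v != 1%g -> exists i j : 'I_n,
  [/\ j = i.+1 :> nat, (v j < v i)%N &
      forall k l : 'I_n, (k < l)%N -> (l <= i)%N -> (v k < v l)%N].
Proof.
move=> v1.
pose D (ij : 'I_n * 'I_n) := (ij.2 == ij.1.+1 :> nat) && (v ij.2 < v ij.1)%N.
have inc hi : (forall ij, D ij -> (hi <= ij.1)%N) ->
    forall k l : 'I_n, (k < l)%N -> (l <= hi)%N -> (v k < v l)%N.
  move=> Dhi k l kl lhi.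
  apply: (@adjacent_chain n (fun i j => v i < v j)%N 0 hi) => //.
    by move=> y x z; apply: ltn_trans.
  move=> i j ji _ jhi; rewrite perm_lt_neq -?val_eqE /= ?ji; last by lia.
  apply/negP => vji; have := Dhi (i, j).
  by rewrite /D /= ji eqxx vji => /(_ isT); lia.
case: (pickP D) => [ij0 D0|noD].
  have [[i j] /= /andP[/= /eqP ji vji] min_i] :=
    arg_minnP (fun ij : 'I_n * 'I_n => val ij.1) D0.
  exists i, j; split=> //; apply: inc => ij; exact: min_i.
case/eqP: v1; apply: perm_lt_inj => i j ij; rewrite !perm1 ij.
by apply: (inc n) => // [ij' | ]; [rewrite noD | apply/ltnW/ltn_ord].
Qed.

(** The heights left after the divided differences for [v]. A column that has
    been lowered to 0 leaves a hole, and the holes end up at the positions of the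
    prefix minima. *)
Definition heights_of n (v : 'S_n) (h : 'I_n -> nat) : Prop :=
  [/\ forall c, (h c < n)%N,
      forall c d, (0 < h c)%N -> h c = h d -> c = d &
      forall i : 'I_n, (0 < i)%N ->
        (exists c, h c = i) <-> (i \notin prefix_minima v)].

(** The last letter of [v] is taken at its first descent [i, j]. Before it, [v] is
    increasing and [v j] is a new minimum, so before the last step the height [j]
    is occupied and the height [i] is free or 0. *)
Lemma schubert_lowered n (u v : 'S_n) b :
  represented u b -> prefix_intervals v ->
  (ell (comp_perm u v) + ell v = ell u)%N ->
  exists (e : bool) (h : 'I_n -> nat), heights_of v h /\
    schubert (comp_perm u v) =
      (-1) ^+ e * coef_det (fun c => 'X^(b c) * lattice_poly (@xvar n) (h c)).
Proof.
move=> [e0 ub]; have [m] := ubnP (ell v); elim: m v => // m IH v vm vI ell_uv.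
have [v1|/first_descent[i [j [ji vji inc]]]] := eqVneq v 1%g.
  exists e0, val; split; last by rewrite v1 /comp_perm mul1g.
  split=> [c|c d _ /val_inj //|i i_gt0]; first exact: ltn_ord.
  split=> [_|_]; last by exists i.
  have n_gt0 : (0 < n)%N by have := ltn_ord i; lia.
  apply/negP=> /(@prefix_minimaP _ _ _ (Ordinal n_gt0))/(_ i_gt0).
  by rewrite v1 !perm1.
have ij : i != j by rewrite -val_eqE /= ji; lia.
set s := tperm i j; set v' := comp_perm v s.
have vE : v = comp_perm v' s by rewrite comp_perm_tpermK.
have v'ij : (v' i < v' j)%N by rewrite !comp_permE tpermL tpermR.
have ell_v : ell v = (ell v').+1 by rewrite vE ell_adjacent.
have uvE : comp_perm u v = comp_perm (comp_perm u v') s.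
  by apply/permP=> k; rewrite !comp_permE tpermK.
have [ell_uv' uv'ji] : (ell (comp_perm u v') + ell v' = ell u)%N /\
    (comp_perm u v' j < comp_perm u v' i)%N.
  have le := ell_comp_perm u v'.
  have [asc|desc] := boolP (comp_perm u v' i < comp_perm u v' j)%N.
    by have := ell_adjacent ji asc; rewrite -/s -uvE; lia.
  rewrite perm_lt_neq // negbK in desc; split=> //.
  have uvK : comp_perm (comp_perm u v) s = comp_perm u v'.
    by rewrite uvE comp_perm_tpermK.
  have : (comp_perm u v i < comp_perm u v j)%N.
    by move: desc; rewrite !comp_permE tpermL tpermR.
  by move=> /(ell_adjacent ji); rewrite -/s uvK; lia.
have fixk (k : 'I_n) : (k < i)%N -> s k = k.
  by move=> ki; rewrite /s tpermD // -val_eqE /=; lia.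
have v'I : prefix_intervals v'.
  move=> a b' c ac bc; rewrite !comp_permE -/s.
  have [[ai cj]|ac'] := eqVneq (a, c) (i, j).
    have si : s i = j by exact: tpermL.
    have sj : s j = i by exact: tpermR.
    rewrite ai cj si sj => _ ib; have [b'i|b'i] := eqVneq b' i.
      by move: ib; rewrite b'i si; lia.
    have lt : (b' < i)%N by move: bc b'i; rewrite cj -val_eqE /=; lia.
    by move: ib; rewrite fixk //; have := inc b' i lt (leqnn _); lia.
  have [[-> ->]|bc'] := eqVneq (b', c) (i, j).
    by rewrite /s tpermL tpermR; lia.
  by apply: vI; apply: tperm_adjacent_lt.
have vj_min (k : 'I_n) : (k < i)%N -> (v j < v k)%N.
  move=> ki; rewrite perm_lt_neq -?val_eqE /=; last by lia.
  by apply/negP => kj; apply: (vI k i j) => //; lia.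
have [|e [h [[h_lt h_inj h_pos] E]]] := IH v' _ v'I ell_uv'.
  by move: vm; rewrite ell_v.
have j_gt0 : (0 < j)%N by rewrite ji.
have [c0 hc0] : exists c, h c = j.
  apply/(h_pos j j_gt0); apply/negP=> /(@prefix_minimaP _ _ _ i).
  by rewrite ji => /(_ (leqnn _)); lia.
have i_min : i \in prefix_minima v'.
  rewrite inE; apply/forallP=> k; apply/implyP=> ki; rewrite !comp_permE tpermL.
  by rewrite -/s fixk // vj_min.
exists e, (fun c => if c == c0 then i : nat else h c); split; last first.
  rewrite uvE schubert_desc // E ddiff_sign // (ddiff_coef_det _ ji hc0) // => c.
  by apply: contraNneq => hc; apply/eqP; apply: h_inj; rewrite hc ?hc0.
have no_i c : (0 < i)%N -> h c != i.
  move=> i_gt0; apply/eqP=> hc; have := proj1 (h_pos i i_gt0) (ex_intro _ c hc).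
  by rewrite i_min.
split=> [c|c d|k k_gt0].
- by case: ifP.
- have [->|cc0] := eqVneq c c0; have [->|dc0] := eqVneq d c0 => //.
  + by move=> i_gt0 /esym/eqP; rewrite (negPf (no_i d i_gt0)).
  + by move=> hc_gt0 hci; have := no_i c; rewrite -hci eqxx => /(_ hc_gt0).
  exact: h_inj.
have [->|kj] := eqVneq k j.
  split=> [[c]|].
    have [_ E1|cc0 hc] := eqVneq c c0; first by move: ji; lia.
    by case/eqP: cc0; apply: h_inj; rewrite hc ?hc0.
  rewrite inE => /forallPn[l]; rewrite negb_imply => /andP[lj].
  have [->|li] := eqVneq l i; first by rewrite vji.
  by rewrite vj_min //; move: li; rewrite -val_eqE /=; lia.
have [ki|ki] := eqVneq k i.
  have i_gt0 : (0 < i)%N by rewrite -ki.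
  rewrite ki; split=> [_|_]; last by exists c0; rewrite eqxx.
  have n_gt0 : (0 < n)%N by have := ltn_ord i; lia.
  apply/negP=> /(@prefix_minimaP _ _ _ (Ordinal n_gt0))/(_ i_gt0).
  by have := inc (Ordinal n_gt0) i i_gt0 (leqnn _); lia.
have -> : (k \in prefix_minima v) = (k \in prefix_minima v').
  have sk : s k = k by rewrite /s tpermD // eq_sym.
  have slk l : (s l < k)%N = (l < k)%N by apply: tperm_adjacent_ltl.
  rewrite !inE; apply/forallP/forallP => H l; apply/implyP; rewrite -slk => lk.
    by have /implyP := H (s l); rewrite !comp_permE sk; apply.
  by have /implyP := H (s l); rewrite !comp_permE sk tpermK; apply.
rewrite -h_pos //; split=> -[c].
  by case: eqP => [_ E1|_ <-]; [move: ki; rewrite -val_eqE /= E1 eqxx | exists c].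
move=> hc; exists c; case: eqP => // E1.
by move: kj; rewrite -val_eqE /= -hc E1 hc0 eqxx.
Qed.

(** * From determinants to proper representations *)

Lemma lattice_rep1 : has_proper_lattice_rep 1.
Proof.
exists 0%N, (fun=> 0%N%:Z), (fun=> (0%N%:Z, 0%N)); split; last by case.
rewrite /lattice_rep (lattice_sum_coef _ (fun=> 0%N) (fun=> 0%N) (fun=> 0%N)).
by rewrite det_mx00.
Qed.

Lemma lattice_rep0 : has_proper_lattice_rep 0.
Proof.
exists 1%N, (fun=> 0%N%:Z), (fun=> (1%N%:Z, 0%N)); split; last first.
  by move=> i j _; rewrite !ord1.
rewrite /lattice_rep (lattice_sum_coef _ (fun=> 0%N) (fun=> 1%N) (fun=> 0%N)).
by rewrite det_mx11 mxE coefXnM.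
Qed.

Lemma to_Zx_coef_det n (b h : 'I_n -> nat) (e : bool) : (forall c, (h c < n)%N) ->
  to_Zx ((-1) ^+ e * coef_det (fun c => 'X^(b c) * lattice_poly (@xvar n) (h c))) =
  (-1) ^+ e * coef_det (fun c => 'X^(b c) * lattice_poly Zvar (h c)).
Proof.
move=> h_lt; pose f : {rmorphism {mpoly int[n]} -> Zx} :=
  mmap intr (fun i : 'I_n => Zvar i).
rewrite -[LHS]/(f _) rmorphM rmorph_sign -coef_det_map; congr (_ * _).
apply: eq_coef_det => c; rewrite rmorphM /= map_polyXn map_lattice_poly.
congr (_ * _); apply: eq_lattice_poly => m mh /=.
have mn := ltn_trans mh (h_lt c); rewrite -[m]/(val (Ordinal mn)) xvarE.
by rewrite mmapX mmap1U.
Qed.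

(** A row [c] of height 0 is the unit vector selecting the coefficient [b c], so
    the other entries for this coefficient do not matter. Reading instead the
    coefficient [K * c.+1], far above all degrees in use, of a polynomial of height
    [n + c] with this degree, gives the same unit vector and distinct heights. *)
Lemma coef_det_lattice_rep n (b h : 'I_n -> nat) (e : bool) : (1 < n)%N ->
  (forall c, (b c < n)%N) -> (forall c, (h c < n)%N) ->
  (forall c d, (0 < h c)%N -> h c = h d -> c = d) ->
  has_proper_lattice_rep
    ((-1) ^+ e * coef_det (fun c => 'X^(b c) * lattice_poly Zvar (h c))).
Proof.
move=> n_gt1 b_lt h_lt h_inj; set F := fun c => _.
have [/existsP[c /existsP[d /and4P[cd /eqP hc /eqP hd /eqP bcd]]]|b_inj] := boolP
    [exists c, exists d, [&& c != d, h c == 0%N, h d == 0%N & b c == b d]].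
  rewrite (coef_det_alternate cd) ?mulr0; first exact: lattice_rep0.
  by rewrite /F hc hd bcd.
have {}b_inj c d : h c = 0%N -> h d = 0%N -> b c = b d -> c = d.
  move=> hc hd bcd; apply/eqP; apply: contraR b_inj => cd.
  by apply/existsP; exists c; apply/existsP; exists d; rewrite cd hc hd bcd !eqxx.
pose K := (4 * n)%N.
pose h' c := if h c == 0%N then (n + c)%N else h c.
pose b' c := if h c == 0%N then (K * c.+1 - (n + c))%N else b c.
pose al (a : 'I_n) : nat :=
  if [pick c | (h c == 0%N) && (b c == a)] is Some c then (K * c.+1)%N else a.
have al0 c (a : 'I_n) : h c = 0%N -> b c = a -> al a = (K * c.+1)%N.
  move=> hc bc; rewrite /al; case: pickP => [d /andP[/eqP hd /eqP bd]|/(_ c)].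
    by rewrite (b_inj d c) // bd.
  by rewrite hc bc !eqxx.
have alP (a : 'I_n) : (exists2 c, h c = 0%N & b c = a /\ al a = (K * c.+1)%N) \/
    (al a = a /\ forall c, h c = 0%N -> b c <> a).
  rewrite /al; case: pickP => [c /andP[/eqP hc /eqP bc]|no]; first by left; exists c.
  by right; split=> // c hc bc; have := no c; rewrite hc bc !eqxx.
pose M := \matrix_(c, a < n) (F c)`_a.
pose M' := \matrix_(c, a < n) ('X^(b' c) * lattice_poly Zvar (h' c))`_(al a).
have M0 c a : h c = 0%N -> M c a = (a == b c :> nat)%:R.
  by move=> hc; rewrite mxE /F hc lattice_poly0 mulr1 coefXn.
have M'0 c a : h c = 0%N -> M' c a = (a == b c :> nat)%:R.
  move=> hc; rewrite mxE /b' /h' hc eqxx coefXnM; have cn := ltn_ord c.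
  have [E|ne] := eqVneq (nat_of_ord a) (b c).
    rewrite (al0 c) // ltnNge leq_subr /=.
    have -> : (K * c.+1 - (K * c.+1 - (n + c)))%N = (n + c)%N by rewrite /K; nia.
    have /monicP := monic_lattice_poly Zvar (n + c).
    by rewrite lead_coefE size_lattice_poly.
  case: ifP => // lt; rewrite nth_default // size_lattice_poly.
  move: lt; case: (alP a) => [[d hd [bd ->]]|[-> _]]; last first.
    by have := ltn_ord a; rewrite /K; nia.
  have dc : d <> c by move=> E; move: ne; rewrite -E bd eqxx.
  have [dc'|dc'] : (d < c \/ c < d)%N.
    by case: (ltngtP d c) => [||/ord_inj//]; [left|right].
    by rewrite /K; nia.
  by rewrite /K; nia.
have M'1 c (a : 'I_n) : h c != 0%N -> (forall d, h d = 0%N -> b d <> a) ->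
    M' c a = M c a.
  move=> hc noa; rewrite !mxE /F /b' /h' (negPf hc).
  by case: (alP a) => [[d hd [bd _]]|[-> _]] //; case: (noa d).
have detM : \det M' = \det M.
  apply: eq_bigr => s _; congr (_ * _).
  have [/existsP[c /andP[/eqP hc sc]]|all0] := boolP
      [exists c, (h c == 0%N) && (s c != b c :> nat)].
    have prod0 (A : 'M[Zx]_n) : A c (s c) = 0 -> \prod_i A i (s i) = 0.
      by move=> A0; rewrite (bigD1 c) //= A0 mul0r.
    by rewrite !prod0 // ?M0 // ?M'0 // (negPf sc).
  have sb c : h c = 0%N -> s c = b c :> nat.
    move=> hc; apply/eqP; apply: contraR all0 => sc.
    by apply/existsP; exists c; rewrite hc eqxx.
  apply: eq_bigr => c _; have [hc|hc] := eqVneq (h c) 0%N; first by rewrite M0 // M'0.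
  apply: M'1 => // d hd bd; case/eqP: hc.
  by rewrite -(@perm_inj _ s d c) //; apply: ord_inj; rewrite sb.
have h'_inj : injective h'.
  move=> c d; rewrite /h'; case: eqP => hc; case: eqP => hd E.
  - by apply: ord_inj; lia.
  - by have := h_lt d; lia.
  - by have := h_lt c; lia.
  by apply: h_inj E; rewrite lt0n; apply/eqP.
pose i0 := Ordinal (ltnW n_gt1); pose i1 := Ordinal n_gt1.
pose s : 'S_n := if e then tperm i0 i1 else 1%g.
exists n, (fun i => (al (s i))%:Z), (fun c => ((b' c)%:Z, h' c)).
split; last exact: h'_inj.
rewrite /lattice_rep (lattice_sum_coef _ (fun i => al (s i))) coef_detE -/M -detM.
have -> : \matrix_(i, j < n) ('X^(b' j) * lattice_poly Zvar (h' j))`_(al (s i)) =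
    row_perm s M'^T by apply/matrixP=> i j; rewrite !mxE.
rewrite row_permE det_mulmx det_perm det_tr; congr (_ ^+ _ * _).
by rewrite /s; case: (e); rewrite ?odd_tperm ?odd_perm1.
Qed.

Theorem theorem4p13 (n : nat) (w : 'S_n) :
  let patterns := [:: [:: 5; 1; 3; 2; 4]; [:: 1; 5; 3; 2; 4];
    [:: 5; 2; 4; 1; 3]; [:: 2; 5; 4; 1; 3]; [:: 5; 3; 1; 4; 2];
    [:: 3; 5; 1; 4; 2]; [:: 3; 1; 5; 4; 2];
    [:: 1; 4; 3; 2; 6; 5]; [:: 1; 4; 3; 6; 2; 5]; [:: 1; 4; 3; 6; 5; 2];
    [:: 1; 4; 6; 3; 5; 2]; [:: 4; 1; 3; 2; 6; 5]; [:: 4; 1; 3; 6; 2; 5]]%N in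
  ((exists u v : 'S_n,
      [/\ w = comp_perm u v,
          avoids u [:: [:: 1; 3; 2; 4]; [:: 2; 4; 1; 3]; [:: 3; 1; 4; 2]]%N,
          avoids v [:: [:: 1; 3; 2]; [:: 3; 1; 2]]%N
        & (ell (comp_perm u v))%:Z = (ell u)%:Z - (ell v)%:Z])
   <-> avoids w patterns) /\
  (avoids w patterns -> has_proper_lattice_rep (to_Zx (schubert w))).
Proof.
move=> patterns; rewrite {}/patterns -/patterns13.
have fact : avoids w patterns13 -> exists u v : 'S_n, [/\ w = comp_perm u v,
    avoids u [:: [:: 1; 3; 2; 4]; [:: 2; 4; 1; 3]; [:: 3; 1; 4; 2]]%N,
    avoids v [:: [:: 1; 3; 2]; [:: 3; 1; 2]]%N
    & (ell (comp_perm u v) + ell v = ell u)%N].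
  by move/admissible_unblocked/admissible_factorization.
split; last first.
  move=> /fact[u [v [wE avu avv ell_uv]]].
  have [n_gt1|n_le1] := ltnP 1 n.
    have [b ub b_lt] := represented_separable avu.
    have vI := avoids_prefix_intervals avv.
    have [e [h [[h_lt h_inj _] E]]] := schubert_lowered ub vI ell_uv.
    by rewrite wE E to_Zx_coef_det //; apply: coef_det_lattice_rep.
  have -> : schubert w = 1.
    have -> : w = w0 n.
      apply/permP=> i; apply: ord_inj.
      by have := ltn_ord (w i); have := ltn_ord (w0 n i); lia.
    rewrite schubert_w0 big1 // => i _.
    by rewrite (_ : (_ - _)%N = 0%N) ?expr0 //; lia.
  rewrite (_ : to_Zx 1 = 1); first exact: lattice_rep1.
  exact: (rmorph1 (mmap intr (fun i : 'I_n => Zvar i)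
    : {rmorphism {mpoly int[n]} -> Zx})).
split=> [[u [v [-> avu avv ell_uv]]]|/fact[u [v [wE avu avv ell_uv]]]].
  apply: admissible_avoids; apply: factorization_admissible avu avv _.
  by move: ell_uv; lia.
by exists u, v; split=> //; lia.
Qed.
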